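(* Let $\mathbb F$ be an algebraically closed field of characteristic different from $2$. (a) Each square matrix $A$ over $\mathbb F$ is congruent to a direct sum, determined uniquely up to permutation of summands, of tridiagonal matrices of the following three types (with $k,n$ positive integers): (i) the $2k\times 2k$ matrix with zero diagonal, all superdiagonal entries (positions $(j,j+1)$) equal to $1$, and all subdiagonal entries (positions $(j+1,j)$) equal to $\lambda$, where $\lambda\in\mathbb F$, $\lambda\neq\pm1$, and each nonzero $\lambda$ is determined up to replacement by $\lambda^{-1}$ (i.e., the type (i) matrices of the same size with parameters $\lambda$ and $\lambda^{-1}$ are congruent); (ii) the $n\times n$ matrix with diagonal $(\varepsilon,0,\dots,0)$, all superdiagonal entries equal to $1$, and subdiagonal entry in position $(j+1,j)$ equal to $(-1)^{j}$ (so the subdiagonal is $-1,1,-1,1,\dots$), where $\varepsilon=1$ if $n$ is a multiple of $4$, and $\varepsilon\in\{0,1\}$ otherwise; (iii) the $4k\times 4k$ matrix with zero diagonal, all superdiagonal entries equal to $1$, and subdiagonal entry in position $(j+1,j)$ equal to $(-1)^{j+1}$ (so the subdiagonal is $1,-1,1,-1,\dots$). (b) The direct sum asserted in (a) is determined uniquely up to permutation of summands by the Kronecker canonical form of $(A^T,A)$ for equivalence. For each direct summand $B$ of types (i)--(iii), the Kronecker canonical form of $(B^T,B)$ is as follows: - if $B$ is of type (i) of size $2k$ with parameter $\lambda$: $(I_k,J_k(\lambda))\oplus(J_k(\lambda),I_k)$; - if $B$ is of type (ii) with $\varepsilon=0$: $(F_k,G_k)\oplus(F_k^T,G_k^T)$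 if $n=2k+1$, and $(I_k,J_k(-1))\oplus(I_k,J_k(-1))$ if $n=2k$ ($k$ is odd); - if $B$ is of type (ii) with $\varepsilon=1$: $(I_n,J_n((-1)^{n+1}))$; - if $B$ is of type (iii) of size $4k$: $(I_{2k},J_{2k}(1))\oplus(I_{2k},J_{2k}(1))$.
   Context: Square matrices $A,A'$ over $\mathbb F$ are congruent if $S^TAS=A'$ for some nonsingular $S$. Matrix pairs $(A,B)$ and $(A',B')$ are equivalent if there are nonsingular $R,S$ with $RAS=A'$ and $RBS=B'$. Direct sums of pairs are taken componentwise: $(A,B)\oplus(A',B')=(A\oplus A',B\oplus B')$. $I_n$ is the $n\times n$ identity matrix and $J_n(\lambda)$ is the $n\times n$ upper triangular Jordan block with eigenvalue $\lambda$ (ones on the superdiagonal). For $n\ge 0$, $F_n$ and $G_n$ are the $n\times(n+1)$ matrices $F_n=[\,I_n\ |\ 0\,]$ (identity followed by a zero column) and $G_n=[\,0\ |\ I_n\,]$ (zero column followed by the identity); $F_0=G_0$ is the $0\times 1$ matrix (taking a direct sum with it adjoins a zero column; with its transpose, a zero row). Kronecker's theorem: each pair of matrices of the same size is equivalent to a direct sum, determined uniquely up to permutation of summands, of pairs of the form $(I_n,J_n(\lambda))$, $(J_n(0),I_n)$, $(F_n,G_n)$, $(F_n^T,G_n^T)$; this direct sum is the Kronecker canonical form of the pair. A summand written $(J_k(\lambda),I_k)$ with $\lambda\ne0$ stands for the equivalent canonical pair $(I_k,J_k(\lambda^{-1}))$. *)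

(* Defs.v *)
From HB Require Import structures.
From mathcomp Require Import all_boot all_algebra.

Set Implicit Arguments.
Unset Strict Implicit.
Unset Printing Implicit Defensive.

Import GRing.Theory.
Local Open Scope ring_scope.

Section Relations.
Variable F : fieldType.

Definition congruent n (A A' : 'M[F]_n) : Prop :=
  exists2 S : 'M[F]_n, S \in unitmx & S^T *m A *m S = A'.

Definition pair_equiv m n (A B A' B' : 'M[F]_(m, n)) : Prop :=
  exists (R : 'M[F]_m) (S : 'M[F]_n),
    [/\ R \in unitmx, S \in unitmx, R *m A *m S = A' & R *m B *m S = B'].

(* Recursion over a sequence rather than \mxdiag, because the Kronecker blocks
   are rectangular, possibly with no rows or no columns. *)
Fixpoint dsum (I : Type) (r c : I -> nat) (M : forall i, 'M[F]_(r i, c i))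
    (s : seq I) : 'M[F]_(sumn (map r s), sumn (map c s)) :=
  match s return 'M[F]_(sumn (map r s), sumn (map c s)) with
  | [::] => 0
  | i :: s' => block_mx (M i) 0 0 (dsum M s')
  end.

End Relations.

Section KroneckerForm.
Variable F : fieldType.

Definition jordan n (a : F) : 'M[F]_n :=
  \matrix_(i, j) (if i == j then a else (j == i.+1 :> nat)%:R).

Definition Fmx n : 'M[F]_(n, n.+1) := \matrix_(i, j) (j == i :> nat)%:R.
Definition Gmx n : 'M[F]_(n, n.+1) := \matrix_(i, j) (j == i.+1 :> nat)%:R.

Variant kblock :=
  | KJordan of nat & F     (* (I_n, J_n(a)) *)
  | KInfty of nat          (* (J_n(0), I_n) *)
  | KFG of nat             (* (F_n, G_n) *)
  | KFGtr of nat.          (* (F_n^T, G_n^T) *)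

Definition kblock_code (b : kblock) : (nat * F) + (nat + (nat + nat)) :=
  match b with
  | KJordan n a => inl (n, a)
  | KInfty n => inr (inl n)
  | KFG n => inr (inr (inl n))
  | KFGtr n => inr (inr (inr n))
  end.

Definition kblock_decode (x : (nat * F) + (nat + (nat + nat))) : kblock :=
  match x with
  | inl (n, a) => KJordan n a
  | inr (inl n) => KInfty n
  | inr (inr (inl n)) => KFG n
  | inr (inr (inr n)) => KFGtr n
  end.

Lemma kblock_codeK : cancel kblock_code kblock_decode.
Proof. by case. Qed.

HB.instance Definition _ := Equality.copy kblock (can_type kblock_codeK).

(* Blocks (I_0, J_0(a)) are empty and would spoil uniqueness, whereas (F_0, G_0)
   is the pair of 0 x 1 matrices and is a genuine summand. *)
Definition kblock_ok (b : kblock) : bool :=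
  match b with
  | KJordan n _ | KInfty n => (0 < n)%N
  | KFG _ | KFGtr _ => true
  end.

Definition krows (b : kblock) : nat :=
  match b with
  | KJordan n _ | KInfty n | KFG n => n
  | KFGtr n => n.+1
  end.

Definition kcols (b : kblock) : nat :=
  match b with
  | KJordan n _ | KInfty n | KFGtr n => n
  | KFG n => n.+1
  end.

Definition kfst (b : kblock) : 'M[F]_(krows b, kcols b) :=
  match b with
  | KJordan n _ => 1%:M
  | KInfty n => jordan n 0
  | KFG n => Fmx n
  | KFGtr n => (Fmx n)^T
  end.

Definition ksnd (b : kblock) : 'M[F]_(krows b, kcols b) :=
  match b with
  | KJordan n a => jordan n a
  | KInfty n => 1%:M
  | KFG n => Gmx n
  | KFGtr n => (Gmx n)^T
  end.

(* The canonical pair equivalent to (J_n(a), I_n). *)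
Definition KJordan_swap (n : nat) (a : F) : kblock :=
  if a == 0 then KInfty n else KJordan n a^-1.

(* The form is represented by its sequence of summands, meaningful up to
   perm_eq; the casts only identify equal dimensions. *)
Definition kronecker_form m n (A B : 'M[F]_(m, n)) (K : seq kblock) : Prop :=
  all kblock_ok K /\
  exists (em : sumn (map krows K) = m) (en : sumn (map kcols K) = n),
    pair_equiv A B (castmx (em, en) (dsum kfst K))
                   (castmx (em, en) (dsum ksnd K)).

End KroneckerForm.

Section TridiagonalForm.
Variable F : fieldType.

(* Indices start at 0: sub j is the entry in row j + 1 and column j, which is
   position (j + 2, j + 1) in the usual numbering. *)
Definition tridiag n (corner : F) (sub : nat -> F) : 'M[F]_n :=
  \matrix_(i, j)
    if (i == 0 :> nat) && (j == 0 :> nat) then corner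
    else if j == i.+1 :> nat then 1
    else if i == j.+1 :> nat then sub j
    else 0.

Definition type1_mx k (a : F) : 'M[F]_(2 * k) := tridiag (2 * k) 0 (fun _ => a).

Definition type2_mx n (eps : bool) : 'M[F]_n :=
  tridiag n eps%:R (fun j => (-1) ^+ j.+1).

Definition type3_mx k : 'M[F]_(4 * k) := tridiag (4 * k) 0 (fun j => (-1) ^+ j).

Variant tblock :=
  | Type1 of nat & F
  | Type2 of nat & bool
  | Type3 of nat.

Definition tblock_code (b : tblock) : (nat * F) + (nat * bool + nat) :=
  match b with
  | Type1 k a => inl (k, a)
  | Type2 n eps => inr (inl (n, eps))
  | Type3 k => inr (inr k)
  end.

Definition tblock_decode (x : (nat * F) + (nat * bool + nat)) : tblock :=
  match x with
  | inl (k, a) => Type1 k a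
  | inr (inl (n, eps)) => Type2 n eps
  | inr (inr k) => Type3 k
  end.

Lemma tblock_codeK : cancel tblock_code tblock_decode.
Proof. by case. Qed.

HB.instance Definition _ := Equality.copy tblock (can_type tblock_codeK).

Definition tblock_ok (b : tblock) : bool :=
  match b with
  | Type1 k a => [&& (0 < k)%N, a != 1 & a != -1]
  | Type2 n eps => (0 < n)%N && ((4 %| n)%N ==> eps)
  | Type3 k => (0 < k)%N
  end.

Definition tsize (b : tblock) : nat :=
  match b with
  | Type1 k _ => (2 * k)%N
  | Type2 n _ => n
  | Type3 k => (4 * k)%N
  end.

Definition tmx (b : tblock) : 'M[F]_(tsize b) :=
  match b with
  | Type1 k a => type1_mx k a
  | Type2 n eps => type2_mx n eps
  | Type3 k => type3_mx k
  end.

Definition tridiag_form n (A : 'M[F]_n) (s : seq tblock) : Prop :=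
  all tblock_ok s /\
  exists e : sumn (map tsize s) = n, congruent A (castmx (e, e) (dsum tmx s)).

(* Equality up to inverting a nonzero parameter; 0^-1 = 0, so the parameter 0
   is identified only with itself. *)
Definition tblock_sim (b b' : tblock) : bool :=
  match b, b' with
  | Type1 k a, Type1 k' a' => (k == k') && ((a == a') || (a == a'^-1))
  | _, _ => b == b'
  end.

Definition same_summands (s s' : seq tblock) : Prop :=
  exists2 t, perm_eq s t & all2 tblock_sim t s'.

End TridiagonalForm.

(* Main.v *)
(* A pencil is a pair of matrices of the same size. If (A^T, A) and (B^T, B) are
   equivalent, say R A^T S = B^T and R A S = B, then P = S^-T R satisfies
   P A = A P^T, and so does every polynomial in P. As P is invertible and 2 <> 0,
   P has a square root Q polynomial in P, and T = Q^T S gives T^T A T = B. Hence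
   congruence of A reduces to Kronecker's theorem for (A^T, A).

   Existence of the Kronecker form: if the first matrix of a pencil does not have
   full row rank, passing to its column space gives a smaller pencil, and the
   form of the latter is lengthened block by block; transposition and a shift by
   an eigenvalue reduce to this case. Uniqueness: the dimensions of the solution
   spaces of A Z X = B Z Y, for X and Y taken from a Kronecker block, are
   additive, and their second differences count the blocks.

   In the form of (A^T, A) the transpose and the swap of the pencil coincide,
   which pairs the blocks of eigenvalue a and 1/a and the blocks (F, G) and
   (F^T, G^T). The blocks J_n(1), n even, and J_n(-1), n odd, occur an even number
   of times, because for the remaining parities J_n is a cosquare and the solution
   space above is then the radical of an alternating form. Such a form is a sum
   of forms of the tridiagonal blocks; these are found by splitting a tridiagonal
   matrix with zero diagonal into two bidiagonal pencils, and the bidiagonal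
   pencils are recognized by the ranks of their linear combinations. *)

From HB Require Import structures.
Require Import Defs.
From mathcomp Require Import all_boot all_algebra.
From mathcomp Require Import zify ring.

Set Implicit Arguments.
Unset Strict Implicit.
Unset Printing Implicit Defensive.

Import GRing.Theory.
Local Open Scope ring_scope.

(** * Pencils up to equivalence *)
Section Pencils.
Variable F : fieldType.

Record pencil := Pencil {
  prow : nat;
  pcol : nat;
  pfst : 'M[F]_(prow, pcol);
  psnd : 'M[F]_(prow, pcol)
}.

Definition invertible_by m n (R : 'M[F]_(m, n)) (R' : 'M[F]_(n, m)) :=
  R *m R' = 1%:M /\ R' *m R = 1%:M.

(* R and S are rectangular in form, so that no cast is needed between
   propositionally equal dimensions. *)
Definition pencil_iso (P Q : pencil) : Prop :=
  exists (R : 'M[F]_(prow Q, prow P)) (R' : 'M[F]_(prow P, prow Q))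
         (S : 'M[F]_(pcol P, pcol Q)) (S' : 'M[F]_(pcol Q, pcol P)),
    [/\ invertible_by R R', invertible_by S S',
        R *m pfst P *m S = pfst Q & R *m psnd P *m S = psnd Q].

Definition padd (P Q : pencil) :=
  Pencil (block_mx (pfst P) 0 0 (pfst Q)) (block_mx (psnd P) 0 0 (psnd Q)).

Definition pzero : pencil := Pencil (0 : 'M[F]_(0, 0)) 0.
Definition ptr (P : pencil) := Pencil (pfst P)^T (psnd P)^T.
Definition pswap (P : pencil) := Pencil (psnd P) (pfst P).

Definition kpencil (b : kblock F) := Pencil (kfst b) (ksnd b).
Definition ksum (K : seq (kblock F)) :=
  Pencil (dsum (@kfst F) K) (dsum (@ksnd F) K).

Local Infix "=~" := pencil_iso (at level 70).
Local Infix ":+:" := padd (at level 50, left associativity).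

Lemma invertible_by1 n : invertible_by (1%:M : 'M_n) 1%:M.
Proof. by split; rewrite mulmx1. Qed.

Lemma invertible_by_sym m n (R : 'M_(m, n)) R' :
  invertible_by R R' -> invertible_by R' R.
Proof. by case. Qed.

Lemma invertible_byM m n p (R : 'M_(m, n)) R' (S : 'M_(n, p)) S' :
  invertible_by R R' -> invertible_by S S' ->
  invertible_by (R *m S) (S' *m R').
Proof.
move=> [RR' R'R] [SS' S'S].
by split; [rewrite mulmxA -(mulmxA R) SS' | rewrite mulmxA -(mulmxA S') R'R];
  rewrite mulmx1.
Qed.

Lemma invertible_by_tr m n (R : 'M_(m, n)) R' :
  invertible_by R R' -> invertible_by R'^T R^T.
Proof. by case=> RR' R'R; split; rewrite -trmx_mul ?RR' ?R'R trmx1. Qed.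

Lemma invertible_by_diag m n p q (R : 'M_(m, n)) R' (S : 'M_(p, q)) S' :
  invertible_by R R' -> invertible_by S S' ->
  invertible_by (block_mx R 0 0 S) (block_mx R' 0 0 S').
Proof.
move=> [RR' R'R] [SS' S'S]; split; rewrite mulmx_block !mul0mx !mulmx0 !addr0 !add0r.
  by rewrite RR' SS' -scalar_mx_block.
by rewrite R'R S'S -scalar_mx_block.
Qed.

Lemma invertible_by_dim m n (R : 'M_(m, n)) R' : invertible_by R R' -> m = n.
Proof.
case=> RR' R'R; apply/eqP; rewrite eqn_leq.
have := mulmx1_min RR'; have := mulmx1_min R'R.
by move=> -> ->.
Qed.

Lemma invertible_by_unit n (R : 'M_n) R' : invertible_by R R' -> R \in unitmx.
Proof. by case=> /mulmx1_unit[]. Qed.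

Lemma unit_invertible_by n (R : 'M_n) : R \in unitmx -> invertible_by R (invmx R).
Proof. by move=> uR; split; rewrite ?mulmxV ?mulVmx. Qed.

Lemma iso_refl P : P =~ P.
Proof.
exists 1%:M, 1%:M, 1%:M, 1%:M; split; try exact: invertible_by1;
  by rewrite mul1mx mulmx1.
Qed.

Lemma iso_sym P Q : P =~ Q -> Q =~ P.
Proof.
case=> R [R' [S [S' [RR' SS' defA defB]]]].
exists R', R, S', S; split; try exact: invertible_by_sym.
  by case: RR' SS' => _ R'R [SS' _]; rewrite -defA !mulmxA R'R mul1mx -mulmxA SS' mulmx1.
by case: RR' SS' => _ R'R [SS' _]; rewrite -defB !mulmxA R'R mul1mx -mulmxA SS' mulmx1.
Qed.

Lemma iso_trans Q P T : P =~ Q -> Q =~ T -> P =~ T.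
Proof.
case=> R1 [R1' [S1 [S1' [hR1 hS1 defA1 defB1]]]].
case=> R2 [R2' [S2 [S2' [hR2 hS2 defA2 defB2]]]].
exists (R2 *m R1), (R1' *m R2'), (S1 *m S2), (S2' *m S1').
split; try exact: invertible_byM.
  by rewrite -defA2 -defA1 !mulmxA.
by rewrite -defB2 -defB1 !mulmxA.
Qed.

Lemma iso_dim P Q : P =~ Q -> prow P = prow Q /\ pcol P = pcol Q.
Proof.
case=> R [R' [S [S' [hR hS _ _]]]].
by rewrite (invertible_by_dim hS) -(invertible_by_dim hR).
Qed.

Lemma iso_add P P' Q Q' : P =~ P' -> Q =~ Q' -> P :+: Q =~ P' :+: Q'.
Proof.
case=> R1 [R1' [S1 [S1' [hR1 hS1 defA1 defB1]]]].
case=> R2 [R2' [S2 [S2' [hR2 hS2 defA2 defB2]]]].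
exists (block_mx R1 0 0 R2), (block_mx R1' 0 0 R2'),
       (block_mx S1 0 0 S2), (block_mx S1' 0 0 S2').
split; try exact: invertible_by_diag; rewrite /= !mulmx_block
  !mul0mx !mulmx0 !addr0 !add0r !mul0mx ?defA1 ?defA2 ?defB1 ?defB2 //.
Qed.

Lemma iso_tr P Q : P =~ Q -> ptr P =~ ptr Q.
Proof.
case=> R [R' [S [S' [hR hS defA defB]]]].
exists S^T, S'^T, R^T, R'^T; split.
- exact/invertible_by_sym/invertible_by_tr.
- exact/invertible_by_sym/invertible_by_tr.
- by rewrite /= -defA !trmx_mul mulmxA.
by rewrite /= -defB !trmx_mul mulmxA.
Qed.

Lemma iso_swap P Q : P =~ Q -> pswap P =~ pswap Q.
Proof. by case=> R [R' [S [S' [hR hS defA defB]]]]; exists R, R', S, S'. Qed.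

Lemma ptr_add P Q : ptr (P :+: Q) = ptr P :+: ptr Q.
Proof. by rewrite /ptr /padd /= !tr_block_mx !trmx0. Qed.

(** Comparing entries through the values of their indices allows dimensions that are equal without
    being convertible. *)
Lemma iso_entries m n m' n' (A B : 'M_(m, n)) (A' B' : 'M_(m', n')) :
    m = m' -> n = n' ->
    (forall (i : 'I_m) (j : 'I_n) (i' : 'I_m') (j' : 'I_n'), i = i' :> nat -> j = j' :> nat ->
       A i j = A' i' j' /\ B i j = B' i' j') ->
  Pencil A B =~ Pencil A' B'.
Proof.
move=> em en; subst m' n' => eqAB.
suff [-> ->] : A = A' /\ B = B' by apply: iso_refl.
by split; apply/matrixP=> i j; have [] := eqAB i j i j.
Qed.

Lemma iso_addC P Q : P :+: Q =~ Q :+: P.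
Proof.
have hI m n : @invertible_by (m + n) (n + m) (block_mx 0 1%:M 1%:M 0) (block_mx 0 1%:M 1%:M 0).
  by split; rewrite mulmx_block !mul0mx !mulmx0 !mulmx1 !addr0 !add0r
    -scalar_mx_block.
exists (block_mx 0 1%:M 1%:M 0), (block_mx 0 1%:M 1%:M 0),
       (block_mx 0 1%:M 1%:M 0), (block_mx 0 1%:M 1%:M 0).
split; try exact: hI;
  by rewrite /= !mulmx_block !mul0mx !mulmx0 !mul1mx !addr0 !add0r
             ?mulmx0 ?mul0mx !mulmx1.
Qed.

Lemma iso_addA P Q T : P :+: (Q :+: T) =~ P :+: Q :+: T.
Proof.
have h A1 A2 A3 : forall (i : 'I_(prow P + (prow Q + prow T)))
      (j : 'I_(pcol P + (pcol Q + pcol T))) (i' : 'I_(prow P + prow Q + prow T)) (j' : 'I_(pcol P + pcol Q + pcol T)),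
    i = i' :> nat -> j = j' :> nat ->
    block_mx (A1 : 'M_(prow P, pcol P)) 0 0 (block_mx (A2 : 'M[F]_(prow Q, pcol Q)) 0 0
       (A3 : 'M_(prow T, pcol T))) i j =
    block_mx (block_mx A1 0 0 A2) 0 0 A3 i' j'.
  move=> i j i' j' ei ej; have := @block_mxA _ _ _ _ _ _ _ A1 0 0 0 A2 0 0 0 A3.
  rewrite /= ?row_mx0 ?col_mx0 => ->; rewrite castmxE /=.
  by congr (fun_of_matrix _ _ _); apply: val_inj.
apply: iso_entries => /=; rewrite ?addnA // => i j i' j' ei ej.
by split; apply: h.
Qed.

Lemma iso_add0 P : P :+: pzero =~ P.
Proof.
apply: iso_entries => /=; rewrite ?addn0 // => i j i' j' ei ej.
have := ltn_ord i; have := ltn_ord j.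
have -> : i = lshift 0 i' by exact: val_inj.
have -> : j = lshift 0 j' by exact: val_inj.
by rewrite !block_mxEul.
Qed.

Lemma iso_addCA P Q T : P :+: (Q :+: T) =~ Q :+: (P :+: T).
Proof.
apply: iso_trans (iso_addA _ _ _) _.
apply: iso_trans (iso_sym (iso_addA _ _ _)).
exact: iso_add (iso_addC _ _) (iso_refl _).
Qed.

Lemma ksum_cons b K : ksum (b :: K) = kpencil b :+: ksum K.
Proof. by []. Qed.

Lemma ksum_nil : ksum [::] = pzero.
Proof. by []. Qed.

Lemma ksum_cat K K' : ksum (K ++ K') =~ ksum K :+: ksum K'.
Proof.
elim: K => [|b K IH] /=.
  by apply: iso_sym; apply: iso_trans (iso_addC _ _) (iso_add0 _).
rewrite !ksum_cons; apply: iso_trans (iso_addA _ _ _).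
exact: iso_add (iso_refl _) IH.
Qed.

Lemma ksum_perm K K' : perm_eq K K' -> ksum K =~ ksum K'.
Proof.
(* The left-hand sequence is frozen as [K0], which leaves a property of a single sequence, the shape
   required by [catCA_perm_ind]. *)
move=> pK; move: K K' pK {-2}K (iso_refl (ksum K)) => K K' pK K0.
move: K K' pK; apply: (catCA_perm_ind (P := fun K => ksum K0 =~ ksum K)) => s1 s2 s3 h.
apply: iso_trans h _; apply: iso_trans (ksum_cat _ _) _.
apply: iso_trans (iso_sym (ksum_cat _ _)).
apply: iso_trans (iso_add (iso_refl _) (ksum_cat _ _)) _.
apply: iso_trans (iso_addCA _ _ _) _.
exact: iso_add (iso_refl _) (iso_sym (ksum_cat _ _)).
Qed.

Lemma ksum1 b : ksum [:: b] =~ kpencil b.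
Proof. by rewrite ksum_cons ksum_nil; apply: iso_add0. Qed.

Lemma pair_equiv_iso n m (A B A' B' : 'M_(m, n)) :
  pair_equiv A B A' B' <-> Pencil A B =~ Pencil A' B'.
Proof.
split=> [[R [S [uR uS defA defB]]]|[R [R' [S [S' [hR hS defA defB]]]]]].
  exists R, (invmx R), S, (invmx S).
  by split=> //; apply: unit_invertible_by.
by exists R, S; split=> //; apply: invertible_by_unit; eassumption.
Qed.

Lemma kronecker_formE m n (A B : 'M_(m, n)) K :
  kronecker_form A B K <-> all (@kblock_ok F) K /\ Pencil A B =~ ksum K.
Proof.
split=> [[okK [em [en h]]] | [okK h]]; split=> //.
  subst m n; apply/pair_equiv_iso.
  by move: h; rewrite !castmx_id.
have [/= em en] := iso_dim h; subst m n.
by exists erefl, erefl; rewrite !castmx_id; apply/pair_equiv_iso.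
Qed.

End Pencils.

Infix "=~" := pencil_iso (at level 70).
Infix ":+:" := padd (at level 50, left associativity).

(** * Existence of the Kronecker form *)
Section KroneckerExistence.
Variable F : fieldType.
Implicit Types P Q : pencil F.

Lemma iso_castmx m n m' n' (e : (m = m') * (n = n')) (A B : 'M[F]_(m, n)) :
  Pencil (castmx e A) (castmx e B) =~ Pencil A B.
Proof.
by case: e => em en; subst m' n'; rewrite !castmx_id; apply: iso_refl.
Qed.

Lemma iso_comb (a b c d : F) P Q : P =~ Q ->
  Pencil (a *: pfst P + b *: psnd P) (c *: pfst P + d *: psnd P) =~
  Pencil (a *: pfst Q + b *: psnd Q) (c *: pfst Q + d *: psnd Q).
Proof.
case=> R [R' [S [S' [hR hS defA defB]]]]; exists R, R', S, S'.
by split=> //=; rewrite mulmxDr mulmxDl -!scalemxAr -!scalemxAl defA defB.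
Qed.

(** The rows of [X] are completed to a basis by a basis of a complement of their span. The right and
    left inverses so obtained coincide. *)
Lemma complete_row_free t n (X : 'M[F]_(t, n)) : row_free X ->
  exists q (W : 'M_(q, n)) (Y : 'M_(n, t + q)), invertible_by (col_mx X W) Y.
Proof.
move=> fX; exists (\rank X^C%MS), (row_base X^C%MS).
have full : row_full (col_mx X (row_base X^C%MS)).
  have e : (X + row_base X^C :=: X + X^C)%MS by apply: adds_eqmx => //; apply: eq_row_base.
  by rewrite /row_full -addsmxE e; apply: addsmx_compl_full.
have free : row_free (col_mx X (row_base X^C%MS)).
  rewrite /row_free (eqP full) mxrank_compl (eqP fX) subnKC //.
  by rewrite -(eqP fX) rank_leq_col.
have [Y hY] := row_fullP full; have [Y' hY'] := row_freeP free.
exists Y; split=> //.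
suff -> : Y = Y' by [].
by rewrite -[Y]mulmx1 -hY' mulmxA hY mul1mx.
Qed.

Lemma invertible_by_flip m n :
  @invertible_by F (m + n) (n + m) (block_mx 0 1%:M 1%:M 0) (block_mx 0 1%:M 1%:M 0).
Proof.
by split; rewrite mulmx_block !mul0mx !mulmx0 !mulmx1 !addr0 !add0r
    -scalar_mx_block.
Qed.

Lemma complete_row_free_up t n (X : 'M[F]_(t, n)) : row_free X ->
  exists q (W : 'M_(q, n)) (Y : 'M_(n, q + t)), invertible_by (col_mx W X) Y.
Proof.
move=> /complete_row_free[q [W [Y hY]]]; exists q, W.
have := invertible_byM (invertible_by_flip q t) hY.
rewrite mul_block_col !mul0mx !mul1mx addr0 add0r => h.
by exists (Y *m block_mx 0 1%:M 1%:M 0).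
Qed.

Definition has_kronecker_form P :=
  exists2 K, all (@kblock_ok F) K & P =~ ksum K.

Lemma has_form_iso P Q : P =~ Q -> has_kronecker_form Q -> has_kronecker_form P.
Proof. by move=> PQ [K okK hK]; exists K => //; apply: iso_trans hK. Qed.

Lemma has_form_add P Q :
  has_kronecker_form P -> has_kronecker_form Q -> has_kronecker_form (P :+: Q).
Proof.
move=> [K okK hK] [K' okK' hK']; exists (K ++ K'); first by rewrite all_cat okK.
by apply: iso_trans (iso_sym (ksum_cat _ _)); apply: iso_add.
Qed.

Lemma has_form_block b : kblock_ok b -> has_kronecker_form (kpencil b).
Proof. by move=> okb; exists [:: b]; rewrite /= ?okb //; apply/iso_sym/ksum1. Qed.

Lemma has_form0 : has_kronecker_form (pzero F).
Proof. by exists [::] => //; apply: iso_refl. Qed.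

(** This pencil is the sum of [q] copies of (J_1(0), I_1), the matrix J_1(0) being zero. *)
Lemma has_form_infty1 q :
  has_kronecker_form (Pencil (0 : 'M[F]_q) 1%:M).
Proof.
elim: q => [|q IH].
  apply: has_form_iso has_form0; apply: iso_entries => // [[]//].
have := has_form_add (@has_form_block (KInfty F 1) isT) IH.
apply: has_form_iso; rewrite /padd /=.
have -> : jordan 1 (0 : F) = 0.
  by apply/matrixP=> i j; rewrite !mxE !ord1.
by rewrite -scalar_mx_block block_mx0; apply: iso_refl.
Qed.

(* A block whose first matrix has a zero last row is lengthened by one; [E]
   selects these last rows, a complement of the column space of [pfst P]. *)
Definition extendable P :=
  exists t (E : 'M_(prow P, t)) (E' : 'M_(t, prow P)) (Z : 'M_(pcol P, prow P)),
    [/\ pfst P *m Z + E *m E' = 1%:M, E' *m E = 1%:M, E' *m pfst P = 0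
      & has_kronecker_form (Pencil (block_mx (pfst P) E 0 0)
                                   (block_mx (psnd P) 0 0 1%:M))].

(** The permutation matrix that exchanges the two middle blocks. It gathers the added rows and
    columns of two lengthened pencils behind the original ones. *)
Lemma invertible_by_perm4 a b c d :
  @invertible_by F ((a + c) + (b + d)) ((a + b) + (c + d))
    (block_mx (block_mx 1%:M 0 0 0) (block_mx 0 0 1%:M 0)
              (block_mx 0 1%:M 0 0) (block_mx 0 0 0 1%:M))
    (block_mx (block_mx 1%:M 0 0 0) (block_mx 0 0 1%:M 0)
              (block_mx 0 1%:M 0 0) (block_mx 0 0 0 1%:M)).
Proof.
split; rewrite !mulmx_block !(mul0mx, mulmx0, mulmx1, addr0, add0r)
  !add_block_mx !(addr0, add0r) !block_mx0 -!scalar_mx_block //.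
Qed.

Lemma extendable_add P Q : extendable P -> extendable Q -> extendable (P :+: Q).
Proof.
move=> [t1 [E1 [E1' [Z1 [h1 h2 h3 h4]]]]] [t2 [E2 [E2' [Z2 [g1 g2 g3 g4]]]]].
exists (t1 + t2)%N, (block_mx E1 0 0 E2), (block_mx E1' 0 0 E2'),
  (block_mx Z1 0 0 Z2); split.
- by rewrite /= !mulmx_block !(mul0mx, mulmx0, addr0, add0r) add_block_mx h1 g1
    !(addr0, add0r) -scalar_mx_block.
- by rewrite /= !mulmx_block !(mul0mx, mulmx0, addr0, add0r) h2 g2 -scalar_mx_block.
- by rewrite /= !mulmx_block !(mul0mx, mulmx0, addr0, add0r) h3 g3 block_mx0.
apply: has_form_iso (has_form_add h4 g4).
have key (A1 : 'M_(prow P, pcol P)) (A2 : 'M_(prow Q, pcol Q)) (U1 : 'M_(_, t1))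
    (U2 : 'M_(_, t2)) (G1 : 'M_t1) (G2 : 'M_t2) :
    block_mx (block_mx 1%:M 0 0 0) (block_mx 0 0 1%:M 0)
              (block_mx 0 1%:M 0 0) (block_mx 0 0 0 1%:M) *m
    block_mx (block_mx A1 0 0 A2) (block_mx U1 0 0 U2) 0 (block_mx G1 0 0 G2) *m
    block_mx (block_mx 1%:M 0 0 0) (block_mx 0 0 1%:M 0)
              (block_mx 0 1%:M 0 0) (block_mx 0 0 0 1%:M)
    = block_mx (block_mx A1 U1 0 G1) 0 0 (block_mx A2 U2 0 G2).
  rewrite -[X in block_mx (block_mx A1 _ _ _) _ X _](@block_mx0 _ t1 t2 (pcol P) (pcol Q)).
  rewrite !(mulmx_block, add_block_mx, mul0mx, mulmx0, mulmx1, mul1mx, addr0, add0r, block_mx0) //.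
do 4![eexists]; split; [exact: invertible_by_perm4|exact: invertible_by_perm4| |].
  by rewrite /= -[X in block_mx (block_mx (pfst P) _ _ _) _ _ X](@block_mx0 _ t1 t2 t1 t2) key.
rewrite /= -[X in block_mx (block_mx (psnd P) _ _ _) X _ _](@block_mx0 _ (prow P) (prow Q) t1 t2).
by rewrite [X in block_mx (block_mx (psnd P) _ _ _) _ _ X]scalar_mx_block key.
Qed.

Lemma iso_unblock0 m n (A B : 'M[F]_(m, n)) (E E' : 'M_(m, 0)) :
  Pencil (block_mx A E 0 0) (block_mx B E' 0 (1%:M : 'M_0)) =~ Pencil A B.
Proof.
apply: iso_trans (iso_add0 (Pencil A B)).
rewrite /padd /= [E]thinmx0 [E']thinmx0 [1%:M]thinmx0; exact: iso_refl.
Qed.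

(** If the first matrix has full row rank, its column space has complement zero, so [t = 0] and
    nothing is lengthened. *)
Lemma extendable_surj P (Z : 'M_(pcol P, prow P)) :
  pfst P *m Z = 1%:M -> has_kronecker_form P -> extendable P.
Proof.
move=> AZ hP; exists 0%N, 0, 0, Z; split.
- by rewrite AZ mulmx0 addr0.
- by apply/matrixP=> [[]].
- by apply/matrixP=> [[]].
by apply: has_form_iso hP; case: (P) => m n A B; apply: iso_unblock0.
Qed.

Lemma Fmx_mul_tr n : Fmx F n *m (Fmx F n)^T = 1%:M.
Proof.
apply/matrixP=> i j; rewrite !mxE (bigD1 (widen_ord (leqnSn n) i)) //= big1.
  by rewrite !mxE /= addr0 eqxx mul1r.
by move=> k /eqP hk; rewrite !mxE; case: eqP => [e|]; rewrite ?mul0r //;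
  case: hk; apply: val_inj.
Qed.

Definition last_col n : 'M[F]_(n, 1) := \col_i (i.+1 == n :> nat)%:R.

Lemma last_col_tr_mul n : (last_col n.+1)^T *m last_col n.+1 = 1%:M.
Proof.
apply/matrixP=> i j; rewrite !mxE !ord1 (bigD1 ord_max) //= big1.
  by rewrite !mxE /= addr0 eqxx mul1r.
move=> k /eqP hk; rewrite !mxE; case: eqP => [e|]; rewrite ?mul0r //.
by case: hk; apply: val_inj => /=; case: e.
Qed.

Lemma jordan0E n i j : jordan n (0 : F) i j = (j == i.+1 :> nat)%:R.
Proof. by rewrite !mxE; case: eqP => // ->; rewrite eqn_leq ltnn andbF. Qed.

Lemma sum_pick n (P : nat -> F) k :
  \sum_(i < n) (i == k :> nat)%:R * P i = (k < n)%:R * P k.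
Proof.
case: ltnP => hk.
  rewrite (bigD1 (Ordinal hk)) //= eqxx mul1r big1 ?addr0 ?mul1r // => i ni.
  by rewrite (_ : (i == k :> nat) = false) ?mul0r //; apply: negbTE.
rewrite big1 ?mul0r // => i _; rewrite (_ : (i == k :> nat) = false) ?mul0r //.
by apply/negbTE; rewrite neq_ltn (leq_trans (ltn_ord i) hk).
Qed.

Lemma eq_ord_nat n (i j : 'I_n) : (i == j) = (i == j :> nat).
Proof. by []. Qed.

End KroneckerExistence.

Ltac bool_lia :=
  do ?[case: eqP => ?]; do ?[case: ltnP => ?];
  rewrite ?mul1n ?mul0n ?muln1 ?muln0 ?addn0 ?add0n //=; first [done | lia | exfalso; lia].
Section ExtendableBlocks.
Variable F : fieldType.
Local Notation last_col := (last_col F).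
(** (I_n, J_n(a)) and (F_n, G_n) have a first matrix of full row rank. In the other two kinds the
    last row of the first matrix is zero, and bordering by the last basis vector gives the block of
    the same kind with [n] increased by one. *)
Lemma extendable_block (b : kblock F) : kblock_ok b -> extendable (kpencil b).
Proof.
case: b => [n a|n|n|n] okb; have hb := has_form_block okb.
- by apply: (extendable_surj (P := kpencil (KJordan n a)) (Z := (1%:M : 'M_n))) => //=; rewrite mulmx1.
- case: n okb hb => // n _ _; exists 1%N, (last_col n.+1), (last_col n.+1)^T, (jordan n.+1 0)^T; split.
  + apply/matrixP=> i j; rewrite /= in i j *; rewrite mxE [X in X + _]mxE [X in _ + X]mxE big_ord1 !mxE.
    under eq_bigr do rewrite [X in _ * X]mxE !jordan0E.
    rewrite (sum_pick _ (fun k => (k == j.+1)%:R)) -!natrM -natrD eq_ord_nat.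
    have hi := ltn_ord i; have hj := ltn_ord j; congr (_%:R); bool_lia.
  + exact: last_col_tr_mul.
  + apply/matrixP=> i j; rewrite /= in i j *; rewrite mxE big1 ?mxE // => k _.
    rewrite jordan0E !mxE -natrM; case: eqP => //= -[->].
    by rewrite mul1n (ltn_eqF (ltn_ord j)).
  apply: has_form_iso (has_form_block (b := KInfty F n.+2) isT).
  apply: iso_entries => //=; rewrite ?addn1 // => i j i' j' ei ej.
  split; rewrite !mxE; case: splitP => k ek; rewrite !mxE; case: splitP => l el;
    rewrite !mxE ?ord1 /= !eq_ord_nat ?ek ?el -?ei -?ej;
    have := ltn_ord k; have := ltn_ord l => hk hl; rewrite /= ?ek ?el; bool_lia.
- exact: (extendable_surj (P := kpencil (KFG F n)) (Z := (Fmx F n)^T) (Fmx_mul_tr F n) hb).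
exists 1%N, (last_col n.+1), (last_col n.+1)^T, (Fmx F n); split.
+ apply/matrixP=> i j; rewrite /= in i j *; rewrite mxE [X in X + _]mxE [X in _ + X]mxE big_ord1 !mxE.
  under eq_bigr do rewrite !mxE [i == _ :> nat]eq_sym.
  rewrite (sum_pick _ (fun k => (j == k :> nat)%:R)) -!natrM -natrD eq_ord_nat.
  have hi := ltn_ord i; have hj := ltn_ord j; congr (_%:R); bool_lia.
+ exact: last_col_tr_mul.
+ apply/matrixP=> i j; rewrite /= in i j *; rewrite mxE big1 ?mxE // => k _.
  rewrite !mxE -natrM; case: eqP => //= -[->].
  by rewrite mul1n (gtn_eqF (ltn_ord j)).
apply: has_form_iso (has_form_block (b := KFGtr F n.+1) isT).
apply: iso_entries => //=; rewrite ?addn1 // => i j i' j' ei ej.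
split; rewrite !mxE; case: splitP => k ek; rewrite !mxE; case: splitP => l el;
    rewrite !mxE ?ord1 /= ?ek ?el -?ei -?ej;
    have := ltn_ord k; have := ltn_ord l => hk hl; rewrite /= ?ek ?el; bool_lia.
Qed.
End ExtendableBlocks.

Section KroneckerStep.
Variable F : fieldType.
Implicit Types P Q : pencil F.

Lemma extendable_ksum (K : seq (kblock F)) :
  all (@kblock_ok F) K -> extendable (ksum K).
Proof.
elim: K => [|b K IH] /=.
  move=> _; apply: (extendable_surj (P := pzero F) (Z := 0) _ (has_form0 F)).
  by apply/matrixP=> [[]].
by case/andP=> okb okK; apply: extendable_add (extendable_block okb) (IH okK).
Qed.

(** Only the component of [X] along the complement [E] matters. It has full row rank, so a change of
    the new columns turns it into an identity, which lengthens blocks of [P], followed by zero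
    columns, which contribute blocks (J_1(0), I_1). *)
Lemma extend_pencil P q (X : 'M_(prow P, q)) :
    extendable P -> row_free (row_mx (pfst P) X) ->
  has_kronecker_form (Pencil (block_mx (pfst P) X 0 0) (block_mx (psnd P) 0 0 1%:M)).
Proof.
case: P X => m n A B X /= [t [E [E' [Z /= [AZ E'E E'A hext]]]]] freeAX.
set X1 := E' *m X.
have defX : X = A *m (Z *m X) + E *m X1 by rewrite !mulmxA -mulmxDl AZ mul1mx.
(* If [v] annihilates [X1], then [v *m E'] annihilates both [A] and [X]. *)
have freeX1 : row_free X1.
  apply: inj_row_free => v vX1.
  have /eqP : (v *m E') *m row_mx A X = 0.
    by rewrite mul_mx_row -!mulmxA E'A -/X1 vX1 mulmx0 row_mx0.
  by rewrite mulmx_free_eq0 // => /eqP vE'; rewrite -[v]mulmx1 -E'E mulmxA vE' mul0mx.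
have [q' [W [Y hY]]] := complete_row_free freeX1.
have X1Y : X1 *m Y = row_mx 1%:M 0.
  by have [h _] := hY; move: h; rewrite mul_col_mx scalar_mx_block => /eq_col_mx[].
(* Subtracting [A *m (Z *m X)] by a column operation spoils the upper right block of the second
   matrix. A row operation using its identity block repairs this, and leaves the first matrix alone
   because the lower rows of that are zero. *)
have h1 : Pencil (block_mx A X 0 0) (block_mx B 0 0 1%:M) =~
          Pencil (block_mx A (E *m X1) 0 0) (block_mx B 0 0 1%:M).
  exists (block_mx 1%:M (B *m (Z *m X)) 0 1%:M),
         (block_mx 1%:M (- (B *m (Z *m X))) 0 1%:M),
         (block_mx 1%:M (- (Z *m X)) 0 1%:M), (block_mx 1%:M (Z *m X) 0 1%:M).
  split; rewrite /invertible_by /= !mulmx_block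
    !(mul0mx, mulmx0, mulmx1, mul1mx, addr0, add0r) ?mulmxN ?(addNr, subrr) -?scalar_mx_block //.
  by rewrite [in X in - _ + X]defX addKr.
(* The change [Y] of the new columns is compensated by its inverse on the new rows, which keeps the
   identity block of the second matrix. *)
have h2 : Pencil (block_mx A (E *m X1) 0 0) (block_mx B 0 0 1%:M) =~
          Pencil (block_mx A (row_mx E 0) 0 0) (block_mx B 0 0 1%:M : 'M_(m + (t + q'), n + (t + q'))).
  exists (block_mx 1%:M 0 0 (col_mx X1 W)), (block_mx 1%:M 0 0 Y),
         (block_mx 1%:M 0 0 Y), (block_mx 1%:M 0 0 (col_mx X1 W)).
  have [YX XY] := hY.
  split; rewrite ?/invertible_by /= !mulmx_block
    !(mul0mx, mulmx0, mulmx1, mul1mx, addr0, add0r) ?XY ?YX -?scalar_mx_block //.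
  by rewrite -mulmxA X1Y mul_mx_row mulmx1 mulmx0.
apply: has_form_iso h1 _; apply: has_form_iso h2 _.
apply: has_form_iso (has_form_add hext (has_form_infty1 F q')).
apply: (iso_trans (Q := Pencil (castmx (esym (addnA _ _ _), esym (addnA _ _ _)) _)
                              (castmx (esym (addnA _ _ _), esym (addnA _ _ _)) _)));
  last exact: iso_castmx.
have /= eA := @block_mxA _ m t q' n t q' A E 0 0 0 0 0 0 (0 : 'M_q').
have /= eB := @block_mxA _ m t q' n t q' B 0 0 0 1%:M 0 0 0 (1%:M : 'M_q').
rewrite !(row_mx0, col_mx0) block_mx0 in eA; rewrite !(row_mx0, col_mx0) -scalar_mx_block in eB.
by rewrite /= eA eB; exact: iso_refl.
Qed.

Lemma has_form_extend P q (X : 'M_(prow P, q)) :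
    has_kronecker_form P -> row_free (row_mx (pfst P) X) ->
  has_kronecker_form (Pencil (block_mx (pfst P) X 0 0) (block_mx (psnd P) 0 0 1%:M)).
Proof.
move=> [K okK [R [R' [S [S' [hR hS defA defB]]]]]] freeAX.
have hext := extend_pencil (X := R *m X) (extendable_ksum okK) _.
apply: has_form_iso (hext _).
  exists (block_mx R 0 0 1%:M), (block_mx R' 0 0 1%:M), (block_mx S 0 0 1%:M),
         (block_mx S' 0 0 1%:M).
  split; try by apply: invertible_by_diag => //; apply: invertible_by1.
    by rewrite /= !mulmx_block !(mul0mx, mulmx0, mulmx1, mul1mx, addr0, add0r) defA.
  by rewrite /= !mulmx_block !(mul0mx, mulmx0, mulmx1, mul1mx, addr0, add0r) defB.
have [freeAX' defAX'] := row_freeP freeAX.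
apply/row_freeP; exists (block_mx S' 0 0 1%:M *m freeAX' *m R').
have [RR' R'R] := hR; have [SS' S'S] := hS.
have -> : row_mx (pfst (ksum K)) (R *m X) =
    R *m row_mx (pfst P) X *m block_mx S 0 0 1%:M.
  rewrite mul_mx_row mul_row_block !(mulmx0, addr0, add0r) mulmx1.
  by rewrite defA.
have [h _] := invertible_by_diag hS (invertible_by1 F q).
by rewrite -!mulmxA (mulmxA _ _ (freeAX' *m R')) h mul1mx (mulmxA _ freeAX') defAX' mul1mx.
Qed.

(** A common left null vector of [A] and [B] becomes the first row after a change of basis, and this
    zero row is the block (F_0^T, G_0^T). *)
Lemma has_form_zero_row m n (A B : 'M[F]_(m, n)) :
    (forall m' (A' B' : 'M[F]_(m', n)), m' < m -> has_kronecker_form (Pencil A' B'))%N ->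
  ~~ row_free (row_mx A B) -> has_kronecker_form (Pencil A B).
Proof.
move=> IH; rewrite -kermx_eq0 => /rowV0Pn[w /sub_kermxP].
rewrite mul_mx_row -row_mx0 => /eq_row_mx[wA wB] nz_w.
have free_w : row_free w by rewrite /row_free rank_rV nz_w.
have [q [W [Y hY]]] := complete_row_free free_w.
have em := invertible_by_dim hY.
apply: has_form_iso (has_form_add (has_form_block (b := KFGtr F 0) isT) (IH q (W *m A) (W *m B) _)); last by rewrite -em.
exists (col_mx w W), Y, 1%:M, 1%:M; split => //; try exact: invertible_by1.
all: rewrite /= mulmx1 mul_col_mx ?wA ?wB block_mxEv !row_thin_mx.
all: by [].
Qed.

(** Let [L] be a basis of the left kernel of [A]. Row and column bases adapted to [L] and [L *m B]
    make the lower rows of the pair equal to (0, 0) and (0, 1). The upper left corner is a smaller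
    pencil, to which induction and [has_form_extend] apply. *)
Lemma has_form_step m n (A B : 'M[F]_(m, n)) :
    (forall m' n' (A' B' : 'M[F]_(m', n')), m' + n' < m + n ->
       has_kronecker_form (Pencil A' B'))%N ->
  ~~ row_free A -> has_kronecker_form (Pencil A B).
Proof.
move=> IH notfreeA.
have [freeAB|] := boolP (row_free (row_mx A B)); last first.
  by apply: has_form_zero_row => m' A' B' lt_m'; apply: IH; rewrite ltn_add2r.
set L := row_base (kermx A).
have LA : L *m A = 0 by apply/sub_kermxP; rewrite eq_row_base.
have freeL : row_free L by apply: row_base_free.
have p_gt0 : (0 < \rank (kermx A))%N by rewrite lt0n mxrank_eq0 kermx_eq0.
(* A relation among the rows of [L *m B] would be a common left null vector of [A] and [B]. *)
have freeLB : row_free (L *m B).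
  apply: inj_row_free => u; rewrite mulmxA => uLB.
  have /eqP : u *m L *m row_mx A B = 0 by rewrite mul_mx_row uLB -mulmxA LA mulmx0 row_mx0.
  by rewrite !mulmx_free_eq0 // => /eqP.
have [q [W [Y hY]]] := complete_row_free_up freeL.
have [q2 [W2 [Y2 hY2]]] := complete_row_free_up freeLB.
(* [W] spans a complement of the left kernel of [A]. *)
have freeWA : row_free (W *m A).
  apply: inj_row_free => v; rewrite mulmxA => /sub_kermxP.
  rewrite -(eq_row_base (kermx A)) => /submxP[u vW].
  have e : row_mx v (- u) *m col_mx W L = 0 by rewrite mul_row_col vW mulNmx subrr.
  have [h _] := hY; move: (congr1 (mulmx^~ Y) e).
  by rewrite -mulmxA h mulmx1 mul0mx -row_mx0 => /eq_row_mx[].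
have em := invertible_by_dim hY; have en := invertible_by_dim hY2.
rewrite -[Y2]hsubmxK in hY2.
set Y21 := lsubmx Y2 in hY2; set Y22 := rsubmx Y2 in hY2.
have [LBY1 LBY2] : L *m B *m Y21 = 0 /\ L *m B *m Y22 = 1%:M.
  have [h _] := hY2; move: h.
  by rewrite mul_col_row scalar_mx_block => /eq_block_mx[].
have hA11 : has_kronecker_form (Pencil (W *m A *m Y21) (W *m B *m Y21)).
  by apply: IH; lia.
have freeA11 : row_free (row_mx (W *m A *m Y21) (W *m A *m Y22)).
  rewrite -mul_mx_row.
  apply: inj_row_free => v; rewrite mulmxA => hv; apply/eqP.
  rewrite -(mulmx_free_eq0 _ freeWA); apply/eqP.
  have [_ h] := hY2.
  by rewrite -[v *m _]mulmx1 -h mulmxA hv mul0mx.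
apply: has_form_iso (has_form_extend hA11 freeA11).
(* This row operation clears the block [W *m B *m Y22] above the identity. *)
have hR : invertible_by (block_mx 1%:M (- (W *m B *m Y22)) 0 1%:M)
            (block_mx 1%:M (W *m B *m Y22) 0 (1%:M : 'M_(\rank (kermx A)))).
  by split; rewrite mulmx_block !(mul0mx, mulmx0, mulmx1, mul1mx, addr0, add0r)
    ?(addNr, subrr) -scalar_mx_block.
exists (block_mx 1%:M (- (W *m B *m Y22)) 0 1%:M *m col_mx W L); eexists.
exists (row_mx Y21 Y22); eexists; split.
- exact: invertible_byM hR hY.
- exact: invertible_by_sym hY2.
- have eA : col_mx W L *m A *m row_mx Y21 Y22 =
      block_mx (W *m A *m Y21) (W *m A *m Y22) 0 0.
    by rewrite mul_col_mx mul_col_row LA !mul0mx.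
  rewrite /= -2!(mulmxA (block_mx _ _ _ _)) eA mulmx_block.
  by rewrite !(mul0mx, mulmx0, mul1mx, addr0).
have eB : col_mx W L *m B *m row_mx Y21 Y22 =
    block_mx (W *m B *m Y21) (W *m B *m Y22) 0 1%:M.
  by rewrite mul_col_mx mul_col_row LBY1 LBY2.
rewrite /= -2!(mulmxA (block_mx _ _ _ _)) eB mulmx_block.
by rewrite !(mul0mx, mulmx0, mul1mx, mulmx1, addr0, add0r) subrr.
Qed.
End KroneckerStep.

Section KroneckerTheorem.
Variable F : closedFieldType.
Implicit Types P Q : pencil F.

(** The matrix [T] reverses the order of the basis, which turns the superdiagonal into the
    subdiagonal. *)
Lemma jordan_tr n (a : F) : exists2 T, T \in unitmx & T *m (jordan n a)^T *m T = jordan n a /\ T *m T = 1%:M.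
Proof.
pose T : 'M[F]_n := \matrix_(i, j) (j == rev_ord i)%:R.
have TE m (M : 'M[F]_(n, m)) i j : (T *m M) i j = M (rev_ord i) j.
  rewrite mxE (bigD1 (rev_ord i)) //= big1 ?addr0 => [|k /negbTE hk].
    by rewrite mxE eqxx mul1r.
  by rewrite mxE hk mul0r.
have TT : T^T = T.
  apply/matrixP=> i j; rewrite !mxE; congr (_%:R).
  by rewrite -(inj_eq rev_ord_inj) rev_ordK eq_sym.
have ET m (M : 'M[F]_(m, n)) i j : (M *m T) i j = M i (rev_ord j).
  by rewrite -[M *m T]trmxK mxE trmx_mul TT TE mxE.
have T2 : T *m T = 1%:M.
  by apply/matrixP=> i j; rewrite TE !mxE rev_ordK eq_sym.
exists T; first by case: (mulmx1_unit T2).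
split=> //; apply/matrixP=> i j; rewrite ET TE !mxE (inj_eq rev_ord_inj) eq_sym.
case: eqP => // _; congr (_%:R).
have := ltn_ord i; have := ltn_ord j => /= hi hj.
by apply/eqP/eqP; lia.
Qed.

Definition kblock_tr (b : kblock F) :=
  match b with KFG n => KFGtr F n | KFGtr n => KFG F n | _ => b end.

Lemma iso_tr_block b : ptr (kpencil b) =~ kpencil (kblock_tr b).
Proof.
case: b => [n a|n|n|n] /=.
- have [T uT [e1 e2]] := jordan_tr n a.
  exists T, T, T, T; split=> //=; by rewrite trmx1 mulmx1.
- have [T uT [e1 e2]] := jordan_tr n (0 : F).
  exists T, T, T, T; split=> //=; by rewrite trmx1 mulmx1.
- exact: iso_refl.
by rewrite /ptr /kpencil /= !trmxK; apply: iso_refl.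
Qed.

Lemma iso_tr_ksum (K : seq (kblock F)) : ptr (ksum K) =~ ksum (map kblock_tr K).
Proof.
elim: K => [|b K IH] /=.
  by rewrite /ptr /= !trmx0; apply: iso_refl.
by rewrite !ksum_cons ptr_add; apply: iso_add (iso_tr_block b) IH.
Qed.

Lemma has_form_tr P : has_kronecker_form (ptr P) -> has_kronecker_form P.
Proof.
move=> [K okK hK]; exists (map kblock_tr K).
  by rewrite all_map; apply: sub_all okK; case.
apply: iso_trans (iso_tr_ksum K).
by have := iso_tr hK; case: (P) => m n A B; rewrite /ptr /= !trmxK.
Qed.

Lemma closed_eigenvalue n (A : 'M[F]_n) : (0 < n)%N ->
  exists a, A - a%:M \notin unitmx.
Proof.
move=> n_gt0; have [|a] := @closed_rootP F (char_poly A) _.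
  by rewrite size_char_poly; case: n A n_gt0.
rewrite -eigenvalue_root_char => /eigenvalueP[v vA nz_v]; exists a.
apply: contra nz_v => uA; rewrite -[v](mulmxK uA).
by rewrite mulmxBr vA mul_mx_scalar subrr mul0mx.
Qed.

Lemma kblock_gt0 (b : kblock F) : kblock_ok b -> (0 < krows b + kcols b)%N.
Proof. by case: b => [n a|n|n|n] /=; lia. Qed.

Lemma row_free_iso P Q : P =~ Q -> row_free (pfst P) = row_free (pfst Q).
Proof.
move=> [R [R' [S [S' [hR hS <- _]]]]].
have [RR' R'R] := hR; have [SS' S'S] := hS.
have rk : \rank (R *m pfst P *m S) = \rank (pfst P).
  rewrite mxrankMfree; last by apply/row_freeP; exists S'.
  rewrite -mxrank_tr trmx_mul mxrankMfree ?mxrank_tr //.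
  by apply/row_freeP; exists R'^T; rewrite -trmx_mul R'R trmx1.
by rewrite /row_free rk (invertible_by_dim hR).
Qed.

Lemma iso_zero_dim P : prow P = 0%N -> pcol P = 0%N -> P =~ pzero F.
Proof.
case: P => m n A B /= m0 n0; apply: iso_entries => // i; move: (ltn_ord i).
by rewrite {2}m0.
Qed.

Lemma iso_pencil_sub (a : F) n m (A B : 'M[F]_(m, n)) Q :
  Pencil (B - a *: A) A =~ Q ->
  Pencil A B =~ Pencil (psnd Q) (pfst Q + a *: psnd Q).
Proof.
move=> /(iso_comb 0 1 1 a) /=.
by rewrite !scale0r !add0r !scale1r subrK.
Qed.

Lemma kronecker_exists P : has_kronecker_form P.
Proof.
case: P => m n A B.
have [N] := ubnP (m + n); elim: N => // N IHN in m n A B *.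
rewrite ltnS => leN.
have IH m' n' (A' B' : 'M[F]_(m', n')) : (m' + n' < m + n)%N ->
    has_kronecker_form (Pencil A' B').
  by move=> lt'; apply: IHN; apply: leq_trans leN.
have [freeA|] := boolP (row_free A); last exact: has_form_step.
have [freeAt|] := boolP (row_free A^T); last first.
  move=> nfree; apply: has_form_tr; apply: has_form_step nfree => m' n' A' B'.
  by move=> lt'; apply: IH; rewrite (addnC m n).
have emn : m = n.
  have := rank_leq_col A; have := rank_leq_col A^T.
  by rewrite (eqP freeA) (eqP freeAt) => ? ?; apply: anti_leq; apply/andP.
subst m; rewrite row_free_unit in freeA => {freeAt}.
have [n0|n_gt0] := posnP n.
  by apply: has_form_iso (has_form0 F); apply: iso_zero_dim.
(* Both matrices are now square and [A] is invertible. Shifting by an eigenvalue [a] of [A^-1 B]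
   gives a pencil with singular first matrix [B - a *: A], of the same size. *)
have [a] := closed_eigenvalue (invmx A *m B) n_gt0 => nunit.
have nfree : ~~ row_free (B - a *: A).
  apply: contra nunit; rewrite row_free_unit => uC.
  have -> : invmx A *m B - a%:M = invmx A *m (B - a *: A).
    by rewrite mulmxBr -scalemxAr mulVmx // scalemx1.
  by rewrite unitmx_mul unitmx_inv freeA.
have [K okK hK] := has_form_step A IH nfree.
(* After the shift is undone, the summands need not be canonical; what remains useful is the
   splitting of the pencil. *)
apply: has_form_iso (iso_pencil_sub hK) _.
case: K okK hK => [|b K] /= okK hK.
  by have [/= en _] := iso_dim hK; move: n_gt0; rewrite en.
case/andP: okK => okb okK.
suff h : has_kronecker_form (Pencil (ksnd b) (kfst b + a *: ksnd b) :+: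
    Pencil (dsum (@ksnd F) K) (dsum (@kfst F) K + a *: dsum (@ksnd F) K)).
  apply: has_form_iso h; rewrite /padd /= scale_block_mx add_block_mx !scaler0 !addr0.
  exact: iso_refl.
have [/= em en] := iso_dim hK.
case: K okK hK em en => [|b2 K] /= okK hK em en.
  apply: has_form_iso (iso_trans (iso_add (iso_refl _)
    (iso_zero_dim (P := Pencil _ _) erefl erefl)) (iso_add0 _)) _.
  rewrite /= ?addn0 in em en.
  have {}hK : Pencil (B - a *: A) A =~ kpencil b := iso_trans hK (ksum1 b).
  (* A single square block is (I_k, J_k(c)) or (J_k(0), I_k). The first has an invertible first
     matrix; the second becomes (I_k, J_k(a)) when the shift is undone. *)
  case: b okb hK em en => [k c|k|k|k] /= okb hK em en; try lia.
    by move: nfree; rewrite (row_free_iso hK) /= row_free_unit unitmx1.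
  apply: has_form_iso (has_form_block (b := KJordan k a) okb).
  apply: iso_entries => // i j i' j' ei ej; rewrite /= !mxE.
  have -> : (i == j) = (i' == j') by rewrite !eq_ord_nat ei ej.
  by split=> //; case: eqP => _; rewrite ?ej ?ei ?mulr1 ?add0r ?mulr0 ?addr0.
(* With at least two blocks, the first summand and the sum of the others both have smaller total
   size, so the induction hypothesis applies to each. *)
case/andP: okK => ok2 _.
have := kblock_gt0 ok2; have := kblock_gt0 okb => h1 h2.
by apply: has_form_add; apply: IH => /=; lia.
Qed.
End KroneckerTheorem.

(** * Invariants of pencils *)
Section Invariants.
Variable F : fieldType.
Implicit Types P Q : pencil F.

Section KernelDim.
Variables (m n p q : nat).
Implicit Type f : {linear 'M[F]_(n, p) -> 'M[F]_(m, q)}.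

Definition ker_dim (f : 'M[F]_(n, p) -> 'M[F]_(m, q)) := \rank (kermx (lin_mx f)).

Lemma ker_mxvecP f Z : reflect (f Z = 0) (mxvec Z <= kermx (lin_mx f))%MS.
Proof.
apply: (iffP sub_kermxP); rewrite mul_vec_lin; last by move=> ->; rewrite linear0.
by move/eqP; rewrite mxvec_eq0 => /eqP.
Qed.

Lemma ker_dim_image f n' p' (phi : {linear 'M[F]_(n, p) -> 'M[F]_(n', p')}) :
  (forall Z, f Z = 0 -> phi Z = 0 -> Z = 0) ->
  \rank (kermx (lin_mx f) *m lin_mx phi) = ker_dim f.
Proof.
move=> inj; rewrite /ker_dim -(mxrank_mul_ker (kermx (lin_mx f)) (lin_mx phi)).
suff -> : (kermx (lin_mx f) :&: kermx (lin_mx phi))%MS = 0 by rewrite mxrank0 addn0.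
apply/eqP; rewrite -submx0; apply/rV_subP => v; rewrite sub_capmx -[v]vec_mxK.
case/andP=> /ker_mxvecP fv /sub_kermxP /eqP; rewrite mul_vec_lin mxvec_eq0 => /eqP phiv.
by rewrite (inj _ fv phiv) linear0 sub0mx.
Qed.

End KernelDim.

Lemma ker_dim_le m n p q m' n' p' q'
    (f : {linear 'M[F]_(n, p) -> 'M[F]_(m, q)})
    (g : {linear 'M[F]_(n', p') -> 'M[F]_(m', q')})
    (phi : {linear 'M[F]_(n, p) -> 'M[F]_(n', p')}) :
  (forall Z, f Z = 0 -> phi Z = 0 -> Z = 0) ->
  (forall Z, f Z = 0 -> g (phi Z) = 0) -> (ker_dim f <= ker_dim g)%N.
Proof.
move=> inj sub; rewrite -(ker_dim_image inj); apply: mxrankS.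
apply/rV_subP => v /submxP[u ->]; rewrite mulmxA.
have : (u *m kermx (lin_mx f) <= kermx (lin_mx f))%MS by apply: submxMl.
rewrite -[u *m _]vec_mxK => /ker_mxvecP fu; rewrite mul_vec_lin.
by apply/ker_mxvecP; apply: sub.
Qed.

(** In the applications [phi] reads off the free parameters of a solution. *)
Lemma ker_dim_eq m n p q d
    (f : {linear 'M[F]_(n, p) -> 'M[F]_(m, q)})
    (phi : {linear 'M[F]_(n, p) -> 'rV[F]_d}) :
  (forall Z, f Z = 0 -> phi Z = 0 -> Z = 0) ->
  (forall t, exists2 Z, f Z = 0 & phi Z = t) -> ker_dim f = d.
Proof.
move=> inj surj; rewrite -(ker_dim_image inj); apply/eqP.
rewrite -[X in _ == X]mul1n -[_ == _]/(row_full _) -sub1mx; apply/rV_subP=> v _.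
rewrite -[v]vec_mxK; have [Z /ker_mxvecP fZ <-] := surj (vec_mx v).
by rewrite -mul_vec_lin; apply: submxMr.
Qed.

Lemma ker_dim0 m n p q (f : {linear 'M[F]_(n, p) -> 'M[F]_(m, q)}) :
  (forall Z, f Z = 0 -> Z = 0) -> ker_dim f = 0%N.
Proof.
move=> inj; apply/eqP; rewrite mxrank_eq0 -submx0; apply/rV_subP => v.
by rewrite -[v]vec_mxK => /ker_mxvecP/inj->; rewrite linear0 sub0mx.
Qed.

Definition sylv m n p q (A B : 'M[F]_(m, n)) (X Y : 'M[F]_(p, q)) (Z : 'M[F]_(n, p)) :=
  A *m Z *m X - B *m Z *m Y.

Lemma sylv_is_linear m n p q A B X Y : linear (@sylv m n p q A B X Y).
Proof.
move=> a Z Z'; rewrite /sylv !(mulmxDr, mulmxDl) -!(scalemxAr, scalemxAl).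
by rewrite scalerBr opprD addrACA.
Qed.

HB.instance Definition _ m n p q A B X Y :=
  GRing.isLinear.Build F _ _ _ (@sylv m n p q A B X Y) (sylv_is_linear A B X Y).

(* For [Y = 1] this is the dimension of the space of morphisms from the pencil
   (1, X) to [P]. *)
Definition hom_dim P p q (X Y : 'M[F]_(p, q)) := ker_dim (sylv (pfst P) (psnd P) X Y).

Lemma hom_dim_iso_le P Q p q (X Y : 'M_(p, q)) : P =~ Q ->
  (hom_dim Q X Y <= hom_dim P X Y)%N.
Proof.
move=> [R [R' [S [S' [[RR' R'R] [SS' S'S] defA defB]]]]].
apply: (@ker_dim_le _ _ _ _ _ _ _ _ _ _ (mulmx S)) => Z hZ /=.
  by move=> SZ; rewrite -[Z]mul1mx -S'S -mulmxA SZ mulmx0.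
have e : sylv (pfst Q) (psnd Q) X Y Z = R *m sylv (pfst P) (psnd P) X Y (S *m Z).
  by rewrite /sylv mulmxBr -defA -defB !mulmxA.
move: (etrans (esym e) hZ) => /(congr1 (mulmx R')).
by rewrite mulmxA R'R mul1mx mulmx0.
Qed.

Lemma hom_dim_iso P Q p q (X Y : 'M_(p, q)) : P =~ Q -> hom_dim P X Y = hom_dim Q X Y.
Proof.
move=> PQ; apply/eqP; rewrite eqn_leq !hom_dim_iso_le //; exact: iso_sym.
Qed.

Definition pad_down m1 m2 n (Z : 'M[F]_(m1, n)) := col_mx Z (0 : 'M_(m2, n)).
Definition pad_up m1 m2 n (Z : 'M[F]_(m2, n)) := col_mx (0 : 'M_(m1, n)) Z.

Lemma pad_down_is_linear m1 m2 n : linear (@pad_down m1 m2 n).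
Proof. by move=> a Z Z'; rewrite /pad_down scale_col_mx add_col_mx scaler0 addr0. Qed.
HB.instance Definition _ m1 m2 n :=
  GRing.isLinear.Build F _ _ _ (@pad_down m1 m2 n) (@pad_down_is_linear m1 m2 n).

Lemma pad_up_is_linear m1 m2 n : linear (@pad_up m1 m2 n).
Proof. by move=> a Z Z'; rewrite /pad_up scale_col_mx add_col_mx scaler0 addr0. Qed.
HB.instance Definition _ m1 m2 n :=
  GRing.isLinear.Build F _ _ _ (@pad_up m1 m2 n) (@pad_up_is_linear m1 m2 n).

Lemma sylv_add P Q p q (X Y : 'M_(p, q)) Z1 Z2 :
  sylv (pfst (P :+: Q)) (psnd (P :+: Q)) X Y (col_mx Z1 Z2) =
  col_mx (sylv (pfst P) (psnd P) X Y Z1) (sylv (pfst Q) (psnd Q) X Y Z2).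
Proof.
rewrite /sylv /= !mul_block_col !mul0mx !add0r !addr0 !mul_col_mx.
by rewrite opp_col_mx add_col_mx.
Qed.

(** The equation for a direct sum decouples into the upper and lower parts of [Z], and the two
    padded kernels are independent. *)
Lemma hom_dim_add P Q p q (X Y : 'M_(p, q)) :
  hom_dim (P :+: Q) X Y = (hom_dim P X Y + hom_dim Q X Y)%N.
Proof.
pose phi1 := @pad_down (pcol P) (pcol Q) p; pose phi2 := @pad_up (pcol P) (pcol Q) p.
set f1 := sylv (pfst P) (psnd P) X Y; set f2 := sylv (pfst Q) (psnd Q) X Y.
set f := sylv (pfst (P :+: Q)) (psnd (P :+: Q)) X Y.
have ff Z1 Z2 : f (col_mx Z1 Z2) = col_mx (f1 Z1) (f2 Z2) := sylv_add X Y Z1 Z2.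
have f10 : f1 0 = 0 := linear0 _; have f20 : f2 0 = 0 := linear0 _.
have inj1 : \rank (kermx (lin_mx f1) *m lin_mx phi1) = ker_dim f1.
  by apply: ker_dim_image => Z _ /eqP; rewrite col_mx_eq0 => /andP[/eqP].
have inj2 : \rank (kermx (lin_mx f2) *m lin_mx phi2) = ker_dim f2.
  by apply: ker_dim_image => Z _ /eqP; rewrite col_mx_eq0 => /andP[_ /eqP].
rewrite /hom_dim -/f1 -/f2 -/f -inj1 -inj2 -mxrank_disjoint_sum.
  apply/eqP; rewrite eqn_leq; apply/andP; split; apply: mxrankS.
    apply/rV_subP => v; rewrite -[v]vec_mxK -[vec_mx v]vsubmxK.
    set Z1 := usubmx _; set Z2 := dsubmx _ => /ker_mxvecP h.
    have /eqP := etrans (esym (ff Z1 Z2)) h; rewrite col_mx_eq0 => /andP[/eqP h1 /eqP h2].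
    have -> : col_mx Z1 Z2 = phi1 Z1 + phi2 Z2.
      by rewrite /phi1 /phi2 /pad_down /pad_up add_col_mx addr0 add0r.
    rewrite linearD /= -[mxvec (phi1 Z1)]mul_vec_lin -[mxvec (phi2 Z2)]mul_vec_lin.
    by apply: addmx_sub_adds; apply: submxMr; apply/ker_mxvecP.
  rewrite addsmx_sub; apply/andP; split; apply/rV_subP => v /submxP[u ->]; rewrite mulmxA.
    have : (u *m kermx (lin_mx f1) <= kermx (lin_mx f1))%MS by apply: submxMl.
    rewrite -[u *m _]vec_mxK => /ker_mxvecP fu; rewrite mul_vec_lin.
    by apply/ker_mxvecP; rewrite [LHS]ff [f1 _]fu f20 col_mx0.
  have : (u *m kermx (lin_mx f2) <= kermx (lin_mx f2))%MS by apply: submxMl.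
  rewrite -[u *m _]vec_mxK => /ker_mxvecP fu; rewrite mul_vec_lin.
  by apply/ker_mxvecP; rewrite [LHS]ff [f2 _]fu f10 col_mx0.
apply/eqP; rewrite -submx0; apply/rV_subP => v; rewrite sub_capmx.
case/andP=> /submxP[u1 e1] /submxP[u2 e2]; move: e2.
rewrite e1 mulmxA [RHS]mulmxA -[u1 *m _]vec_mxK -[u2 *m _]vec_mxK !mul_vec_lin.
move/(can_inj mxvecK)/eq_col_mx => [-> _].
by rewrite (linear0 phi1) linear0 sub0mx.
Qed.

Lemma hom_dim_ksum K p q (X Y : 'M_(p, q)) :
  hom_dim (ksum K) X Y = (\sum_(b <- K) hom_dim (kpencil b) X Y)%N.
Proof.
elim: K => [|b K IH]; last by rewrite ksum_cons hom_dim_add IH big_cons.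
rewrite big_nil; apply/ker_dim0 => Z _; by apply/matrixP=> [[]].
Qed.

End Invariants.

(** * Values of the invariants on Kronecker blocks *)

Section ProbeValues.
Variable F : fieldType.

Lemma upper_triangular_unit n (M : 'M[F]_n) :
  (forall i j : 'I_n, (j < i)%N -> M i j = 0) -> (forall i, M i i != 0) ->
  M \in unitmx.
Proof.
move=> tri diag; rewrite -unitmx_tr unitmxE det_trig.
  by rewrite unitfE; apply/prodf_neq0 => i _; rewrite mxE.
by apply/is_trig_mxP => i j ij; rewrite mxE tri.
Qed.

Lemma jordan_diag0 n (a : F) : jordan n a = a%:M + jordan n 0.
Proof.
apply/matrixP=> i j; rewrite !mxE; case: (eqVneq i j) => _; first by rewrite addr0.
by rewrite add0r.
Qed.

Lemma jordan_unit n (a : F) : a != 0 -> jordan n a \in unitmx.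
Proof.
move=> nz_a; apply: upper_triangular_unit => [i j ji|i]; rewrite mxE ?eqxx //.
by rewrite eq_ord_nat (gtn_eqF ji) (ltn_eqF (ltnW ji : j < i.+1)%N).
Qed.

Lemma unit_id_sub_jordan n (a : F) : 1%:M - a *: jordan n 0 \in unitmx.
Proof.
apply: upper_triangular_unit => [i j ji|i].
  rewrite !mxE eq_ord_nat (gtn_eqF ji).
  by rewrite (ltn_eqF (ltnW ji : j < i.+1)%N) mulr0 subr0.
by rewrite !mxE eqxx mulr0 subr0 oner_neq0.
Qed.

Lemma row_free_mulr m n p (C : 'M[F]_(m, n)) (D : 'M_(n, p)) :
  row_free (C *m D) -> row_free C.
Proof. by rewrite -!kermx_eq0 => /eqP h; rewrite -submx0 -h; apply/sub_kermxP; rewrite mulmxA mulmx_ker mul0mx. Qed.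

Lemma Fmx_Gtr n : Fmx F n *m (Gmx F n)^T = (jordan n 0)^T.
Proof.
apply/matrixP=> i j; rewrite mxE.
under eq_bigr do rewrite !mxE.
rewrite (sum_pick _ (fun k => (k == j.+1)%:R)) leqW ?mul1r; last exact: ltn_ord.
by rewrite mxE jordan0E.
Qed.

Lemma Gmx_Ftr n : Gmx F n *m (Fmx F n)^T = jordan n 0.
Proof. by rewrite -[LHS]trmxK trmx_mul trmxK Fmx_Gtr trmxK. Qed.

Lemma Gmx_mul_tr n : Gmx F n *m (Gmx F n)^T = 1%:M.
Proof.
apply/matrixP=> i j; rewrite mxE.
under eq_bigr do rewrite !mxE.
rewrite (sum_pick _ (fun k => (k == j.+1)%:R)) ltnS ltn_ord mul1r eqSS.
by rewrite mxE eq_ord_nat.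
Qed.

Lemma FG_comb_row_free n (x y : F) : (x != 0) || (y != 0) ->
  row_free (x *: Fmx F n + y *: Gmx F n).
Proof.
case: (eqVneq x 0) => [-> /= nz_y|nz_x _].
  rewrite scale0r add0r; apply: (@row_free_mulr _ _ _ _ (Gmx F n)^T).
  by rewrite -scalemxAl Gmx_mul_tr row_free_unit scalemx1 unitmxE det_scalar unitrX // unitfE.
apply: (@row_free_mulr _ _ _ _ (Fmx F n)^T).
rewrite mulmxDl -!scalemxAl Fmx_mul_tr Gmx_Ftr row_free_unit.
have -> : x *: 1%:M + y *: jordan n 0 = x *: (1%:M - (- y / x) *: jordan n 0).
  by rewrite scalerBr scalerA mulrCA divff // mulr1 scaleNr opprK.
rewrite unitmxE detZ unitrM -unitmxE unit_id_sub_jordan andbT.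
by rewrite unitrX // unitfE.
Qed.

Lemma col_injective m n k (C : 'M[F]_(m, n)) (Z : 'M_(n, k)) :
  row_free C^T -> C *m Z = 0 -> Z = 0.
Proof.
move=> fC /(congr1 trmx)/eqP; rewrite trmx_mul trmx0 mulmx_free_eq0 // => /eqP.
by move/(congr1 trmx); rewrite trmxK trmx0.
Qed.

(** Column [k] of the right-hand side is [A] times column [k - 1] of [Z], and zero for [k = 0];
    since [C] is injective, the columns vanish one after the other. *)
Lemma sylv_nilpotent_inj m n j (C A : 'M[F]_(m, n)) (Z : 'M_(n, j)) :
  row_free C^T -> C *m Z = A *m Z *m jordan j 0 -> Z = 0.
Proof.
move=> fC eqZ.
suff h N (k : 'I_j) : (k < N)%N -> col k Z = 0.
  by apply/matrixP=> i k; have := congr1 (fun v => fun_of_matrix v i ord0) (h _ k (ltn_ord k)); rewrite !mxE.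
elim: N k => // N IH k ltk; apply: (col_injective fC).
rewrite colE mulmxA eqZ -colE; apply/matrixP=> i z; rewrite !mxE.
rewrite big1 // => l _; rewrite jordan0E.
case: eqP => [ek|]; last by rewrite mulr0.
have /(congr1 (fun v => (A *m v) i ord0)) : col l Z = 0.
  by apply: IH; rewrite -ltnS -ek.
by rewrite colE mulmxA -colE mulmx0 !mxE => ->; rewrite mul0r.
Qed.

Lemma hom_eq_nilpotent m n j (A B : 'M[F]_(m, n)) a (Z : 'M_(n, j)) :
  A *m Z *m jordan j a = B *m Z *m 1%:M ->
  (B - a *: A) *m Z = A *m Z *m jordan j 0.
Proof.
rewrite mulmx1 jordan_diag0 mulmxDr mul_mx_scalar mulmxBl -scalemxAl => <-.
by rewrite addrAC subrr add0r.
Qed.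

Lemma hom_dim_jordan0 m n j a (A B : 'M[F]_(m, n)) : row_free (B - a *: A)^T ->
  hom_dim (Pencil A B) (jordan j a) 1%:M = 0%N.
Proof.
move=> freeC; apply: ker_dim0 => Z /eqP; rewrite subr_eq0 => /eqP /= eqZ.
exact: (sylv_nilpotent_inj freeC (hom_eq_nilpotent eqZ)).
Qed.

(** The equation says that each row of [Z] is the preceding one times the Jordan block, so the first
    row is arbitrary and determines [Z]. *)
Lemma hom_dim_KFG n j a : hom_dim (kpencil (KFG F n)) (jordan j a) 1%:M = j.
Proof.
have eqrow (Z : 'M[F]_(n.+1, j)) : sylv (Fmx F n) (Gmx F n) (jordan j a) 1%:M Z = 0 <->
    forall i : 'I_n, row (lift ord0 i) Z = row (widen_ord (leqnSn n) i) Z *m jordan j a.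
  have eF i : row i (Fmx F n *m Z) = row (widen_ord (leqnSn n) i) Z.
    apply/rowP=> k; rewrite !mxE; under eq_bigr do rewrite mxE.
    rewrite (bigD1 (widen_ord (leqnSn n) i)) //= eqxx mul1r big1 ?addr0 // => l.
    by rewrite eq_ord_nat /= => /negbTE->; rewrite mul0r.
  have eG i : row i (Gmx F n *m Z) = row (lift ord0 i) Z.
    apply/rowP=> k; rewrite !mxE; under eq_bigr do rewrite mxE.
    rewrite (bigD1 (lift ord0 i)) //= eqxx mul1r big1 ?addr0 // => l.
    by rewrite eq_ord_nat /= => /negbTE->; rewrite mul0r.
  split=> [/eqP|h].
    rewrite subr_eq0 mulmx1 => /eqP e i.
    by rewrite -eG -e row_mul eF.
  apply/eqP; rewrite subr_eq0 mulmx1; apply/eqP/row_matrixP=> i.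
  by rewrite eG h row_mul eF.
pose phi := fun Z : 'M[F]_(n.+1, j) => row ord0 Z.
apply: (@ker_dim_eq _ _ _ _ _ _ _ phi) => [Z /eqrow hZ phi0|t].
  suff h N (i : 'I_n.+1) : (i < N)%N -> row i Z = 0.
    by apply/row_matrixP=> i; rewrite (h _ i (ltn_ord i)) row0.
  elim: N i => // N IH i ltiN.
  case: (unliftP ord0 i) => [i'|] ei; last by rewrite ei.
  by rewrite ei hZ IH ?mul0mx //; rewrite ei in ltiN.
exists (\matrix_i iter i (mulmx^~ (jordan j a)) t); last by rewrite [LHS]rowK.
by apply/eqrow => i; rewrite !rowK.
Qed.

(** Indices are natural numbers and the value outside the matrix is 0, so products with shift
    matrices need no separate boundary case. *)
Definition entry m n (Z : 'M[F]_(m, n)) (i k : nat) : F :=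
  if insub i is Some i' then if insub k is Some k' then Z i' k' else 0 else 0.

Lemma entryE m n (Z : 'M_(m, n)) (i : 'I_m) (k : 'I_n) : entry Z i k = Z i k.
Proof. by rewrite /entry !valK. Qed.

Lemma entry_out_row m n (Z : 'M_(m, n)) i k : (m <= i)%N -> entry Z i k = 0.
Proof. by rewrite leqNgt => h; rewrite /entry insubN. Qed.

Lemma entry_out_col m n (Z : 'M_(m, n)) i k : (n <= k)%N -> entry Z i k = 0.
Proof. by rewrite leqNgt => h; rewrite /entry; case: insub => // i'; rewrite insubN. Qed.

Lemma entry_mx m n (f : nat -> nat -> F) i k : (i < m)%N -> (k < n)%N ->
  entry (\matrix_(i < m, k < n) f i k) i k = f i k.
Proof. by move=> hi hk; rewrite /entry !insubT mxE. Qed.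

Definition row_slice m n i c d (Z : 'M[F]_(m, n)) := \row_(s < d) entry Z i (s + c).

Lemma row_slice_is_linear m n i c d : linear (@row_slice m n i c d).
Proof.
move=> a Z Z'; apply/rowP=> s; rewrite !mxE /entry.
case: insub => [i'|]; last by rewrite mulr0 addr0.
by case: insub => [k'|]; rewrite ?mxE // mulr0 addr0.
Qed.

HB.instance Definition _ m n i c d :=
  GRing.isLinear.Build F _ _ _ (@row_slice m n i c d) (@row_slice_is_linear m n i c d).

Definition shift_right (z : nat -> F) k := if k is k'.+1 then z k' else 0.

Lemma sum_entry_row m n (Z : 'M_(m, n)) s k :
  \sum_(i < m) (i == s :> nat)%:R * Z i k = entry Z s k.
Proof.
case: (ltnP s m) => hs.
  rewrite (bigD1 (Ordinal hs)) //= eqxx mul1r big1 ?addr0; first by rewrite -entryE.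
  by move=> i; rewrite eq_ord_nat => /negbTE /= ->; rewrite mul0r.
rewrite entry_out_row // big1 // => i _.
by rewrite ltn_eqF ?mul0r // (leq_trans (ltn_ord i)).
Qed.

Lemma sum_entry_col m n (Z : 'M_(m, n)) s i :
  \sum_(k < n) Z i k * (k == s :> nat)%:R = entry Z i s.
Proof.
case: (ltnP s n) => hs.
  rewrite (bigD1 (Ordinal hs)) //= eqxx mulr1 big1 ?addr0; first by rewrite -entryE.
  by move=> k; rewrite eq_ord_nat => /negbTE /= ->; rewrite mulr0.
rewrite entry_out_col // big1 // => k _.
by rewrite ltn_eqF ?mulr0 // (leq_trans (ltn_ord k)).
Qed.

Lemma jordan0_mulE m n (Z : 'M_(m, n)) i k : (jordan m 0 *m Z) i k = entry Z i.+1 k.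
Proof. by rewrite mxE; under eq_bigr do rewrite jordan0E; apply: sum_entry_row. Qed.

Lemma Fmx_mulE m n (Z : 'M_(m.+1, n)) i k : (Fmx F m *m Z) i k = entry Z i k.
Proof. by rewrite mxE; under eq_bigr do rewrite mxE; apply: sum_entry_row. Qed.

Lemma Gmx_mulE m n (Z : 'M_(m.+1, n)) i k : (Gmx F m *m Z) i k = entry Z i.+1 k.
Proof. by rewrite mxE; under eq_bigr do rewrite mxE; apply: sum_entry_row. Qed.

Lemma mul_FmxE m n (Z : 'M_(m, n)) i k : (Z *m Fmx F n) i k = entry Z i k.
Proof.
rewrite mxE; under eq_bigr do rewrite mxE [k == _ :> nat]eq_sym.
exact: sum_entry_col.
Qed.

Lemma mul_succ_colE m n p (Z : 'M_(m, n)) (M : 'M[F]_(n, p)) :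
    (forall l k, M l k = (k == l.+1 :> nat)%:R) ->
  forall i k, (Z *m M) i k = shift_right (entry Z i) k.
Proof.
move=> eM i k; rewrite mxE; under eq_bigr do rewrite eM.
case: (nat_of_ord k) => [|k'] /=; first by rewrite big1 // => l _; rewrite mulr0.
by under eq_bigr do rewrite eqSS eq_sym; apply: sum_entry_col.
Qed.

(** Subtracting the eigenvalue leaves the condition that [Z] commutes with the nilpotent shifts.
    Hence [Z] is upper triangular Toeplitz, given by its first row, and the missing row below [Z]
    forces all but the last [minn n j] entries of that row to vanish. *)
Lemma hom_dim_KJordan n j (a : F) :
  (0 < n)%N -> hom_dim (kpencil (KJordan n a)) (jordan j a) 1%:M = minn n j.
Proof.
case: n => // n _; set d := minn n.+1 j.
have eqZ (Z : 'M[F]_(n.+1, j)) : sylv 1%:M (jordan n.+1 a) (jordan j a) 1%:M Z = 0 <->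
    forall (i : 'I_n.+1) (k : 'I_j), entry Z i.+1 k = shift_right (entry Z i) k.
  have e1 i k := jordan0_mulE Z i k.
  have e2 i k := mul_succ_colE Z (@jordan0E F j) i k.
  split=> [/eqP|h].
    rewrite subr_eq0 => /eqP/hom_eq_nilpotent.
    rewrite scalemx1 jordan_diag0 addrAC subrr add0r mul1mx => e i k.
    by rewrite -e1 e e2.
  have e : jordan n.+1 0 *m Z = Z *m jordan j 0.
    by apply/matrixP=> i k; rewrite e1 e2.
  apply/eqP; rewrite subr_eq0 mulmx1 mul1mx (jordan_diag0 n.+1) (jordan_diag0 j).
  by rewrite mulmxDr mulmxDl e mul_mx_scalar mul_scalar_mx.
pose phi := @row_slice n.+1 j 0 (j - d) d.
apply: (@ker_dim_eq F _ _ _ _ _ _ phi) => [Z /eqZ hZ phi0|t].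
  have diagZ i k : (i <= n)%N -> (k < j)%N ->
      entry Z i k = if (k < i)%N then 0 else entry Z 0 (k - i).
    elim: i k => [|i IH] k lei ltk; first by rewrite subn0.
    have := hZ (Ordinal (ltnW lei : i < n.+1)%N) (Ordinal ltk) => /= ->.
    case: k ltk => [|k] ltk //=.
    by rewrite IH ?subSS ?ltnS //; apply: ltnW.
  have zero0 s : (s < j)%N -> entry Z 0 s = 0.
    move=> lts; case: (ltnP s (j - d)) => hs.
      have ltn1 : (n + s < j)%N by move: hs; rewrite /d; lia.
      have := diagZ n (n + s)%N (leqnn _) ltn1; rewrite ltnNge leq_addr /= addKn => <-.
      have ltn2 : ((n + s).+1 < j)%N by move: hs; rewrite /d; lia.
      by have := hZ ord_max (Ordinal ltn2) => /= <-; rewrite entry_out_row.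
    have hsd : (s - (j - d) < d)%N by move: hs; rewrite /d; lia.
    have := congr1 (fun v : 'rV_d => v 0 (Ordinal hsd)) phi0.
    by rewrite !mxE /= subnK.
  apply/matrixP=> i k; rewrite mxE -entryE diagZ ?ltn_ord // -1?ltnS ?ltn_ord //.
  by case: ltnP => // _; rewrite zero0 // (leq_ltn_trans (leq_subr _ _)) ?ltn_ord.
(* The Toeplitz matrix whose first row is [t] preceded by [j - d] zeros. *)
pose T i k := if (i + (j - d) <= k)%N then entry t 0 (k - i - (j - d)) else 0.
exists (\matrix_(i < n.+1, k < j) T i k).
  apply/eqZ => i k.
  have -> : shift_right (entry (\matrix_(i < n.+1, k < j) T i k) i) k = shift_right (T i) k.
    case: (nat_of_ord k) (ltn_ord k) => //= k' ltk'.
    by rewrite entry_mx // ltnW.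
  case: (ltnP i.+1 n.+1) => hi.
    rewrite entry_mx // /T; case: (nat_of_ord k) => [|k'] //=.
  rewrite entry_out_row //; case: (nat_of_ord k) (ltn_ord k) => //= k' ltk'.
  rewrite /T; case: leqP => // h; exfalso.
  by have := ltn_ord i; move: h hi ltk'; rewrite /d; lia.
apply/rowP=> s; rewrite mxE.
have ltj : (s + (j - d) < j)%N by have := ltn_ord s; rewrite /d; lia.
by rewrite entry_mx // /T leq_addl subn0 addnK (entryE t ord0 s).
Qed.

Lemma hom_dim_jordan (b : kblock F) j a : kblock_ok b ->
  hom_dim (kpencil b) (jordan j a) 1%:M =
  match b with
  | KJordan n c => if c == a then minn n j else 0
  | KFG _ => j
  | _ => 0
  end.
Proof.
case: b => [n c|n|n|n] /= okb.
- case: eqP => [->|/eqP nca]; first exact: hom_dim_KJordan.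
  apply: hom_dim_jordan0; rewrite /= row_free_unit unitmx_tr scalemx1 jordan_diag0.
  rewrite addrAC -raddfB -jordan_diag0; apply: jordan_unit.
  by rewrite subr_eq0.
- by apply: hom_dim_jordan0; rewrite row_free_unit unitmx_tr unit_id_sub_jordan.
- exact: hom_dim_KFG.
apply: hom_dim_jordan0; rewrite raddfB /= trmxK linearZ /= trmxK addrC -scaleNr.
by rewrite -[Gmx _ _]scale1r FG_comb_row_free // oner_neq0 orbT.
Qed.

(** With columns z_0, ..., z_(j-1) of [Z], the equation reads A z_0 = 0, A z_k = B z_(k-1) and B
    z_(j-1) = 0. The columns vanish in increasing order if [A] is injective, in decreasing order if
    [B] is. *)
Lemma hom_dim_FG0 m n j (A B : 'M[F]_(m, n)) : row_free A^T \/ row_free B^T ->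
  hom_dim (Pencil A B) (Fmx F j) (Gmx F j) = 0%N.
Proof.
move=> inj; apply: ker_dim0 => Z /eqP; rewrite subr_eq0 => /eqP /= eqZ.
have eqcol i k : entry (A *m Z) i k = shift_right (entry (B *m Z) i) k.
  case: (ltnP i m) => hi; last first.
    by rewrite entry_out_row //; case: k => //= k; rewrite entry_out_row.
  case: (ltnP k j.+1) => hk; last first.
    rewrite entry_out_col ?(ltnW hk) //; case: k hk => //= k hk.
    by rewrite entry_out_col.
  have := mul_FmxE (A *m Z) (Ordinal hi) (Ordinal hk) => <-.
  rewrite eqZ; apply: (mul_succ_colE (B *m Z) _ (Ordinal hi) (Ordinal hk)).
  by move=> l k'; rewrite mxE.
suff colZ (k : 'I_j) : col k Z = 0.
  by apply/matrixP=> i k; have := congr1 (fun v => fun_of_matrix v i ord0) (colZ k); rewrite !mxE.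
have entry_col (M : 'M[F]_(m, n)) (l : 'I_j) i : (M *m col l Z) i ord0 = entry (M *m Z) i l.
  by rewrite entryE colE mulmxA -colE mxE.
case: inj => inj.
  suff h N (k' : 'I_j) : (k' < N)%N -> col k' Z = 0 by apply: h (ltn_ord k).
  elim: N k' => // N IH k' ltk; apply: (col_injective inj); apply/colP=> i.
  rewrite [RHS]mxE [LHS](_ : _ = (A *m col k' Z) i ord0) ?entry_col ?eqcol; last by [].
  case ek: (nat_of_ord k') => [//|k1] /=.
  have ltk1 : (k1 < j)%N by rewrite -ltnS -ek ltnW ?ltnS ?ltn_ord.
  rewrite (_ : k1 = Ordinal ltk1) // -entry_col IH ?mulmx0 ?mxE //=.
  by rewrite -ltnS -ek.
suff h N (k' : 'I_j) : (j - k' <= N)%N -> col k' Z = 0 by apply: h (leqnn _).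
elim: N k' => [|N IH] k' ltk.
  by have := ltn_ord k'; move: ltk; lia.
apply: (col_injective inj); apply/colP=> i.
rewrite [RHS]mxE [LHS](_ : _ = (B *m col k' Z) i ord0) ?entry_col; last by [].
have /= <- := eqcol i k'.+1.
case: (ltnP k'.+1 j) => hk; last by rewrite entry_out_col.
rewrite (_ : k'.+1 = Ordinal hk) // -entry_col IH ?mulmx0 ?mxE //=.
by move: ltk; lia.
Qed.

(** Solutions are Hankel matrices, constant along antidiagonals, and are given by their last row.
    Antidiagonals that leave the matrix at the right edge carry zeros, so only the first [j - n]
    entries of the last row are free. *)
Lemma hom_dim_KFG_FG n j :
  hom_dim (kpencil (KFG F n)) (Fmx F j) (Gmx F j) = (j - n)%N.
Proof.
have eqZ (Z : 'M[F]_(n.+1, j)) : sylv (Fmx F n) (Gmx F n) (Fmx F j) (Gmx F j) Z = 0 <->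
    forall i k, (i < n)%N -> entry Z i k = shift_right (entry Z i.+1) k.
  have eF i k : (i < n)%N -> entry (Fmx F n *m Z) i k = entry Z i k.
    move=> hi; case: (ltnP k j) => hk; last by rewrite !entry_out_col.
    by rewrite (entryE _ (Ordinal hi) (Ordinal hk)) Fmx_mulE.
  have eG i k : (i < n)%N -> entry (Gmx F n *m Z) i k = entry Z i.+1 k.
    move=> hi; case: (ltnP k j) => hk; last by rewrite !entry_out_col.
    by rewrite (entryE _ (Ordinal hi) (Ordinal hk)) Gmx_mulE.
  have e1 i k : (Fmx F n *m Z *m Fmx F j) i k = entry Z i k.
    by rewrite mul_FmxE eF.
  have e2 i k : (Gmx F n *m Z *m Gmx F j) i k = shift_right (entry Z i.+1) k.
    rewrite mul_succ_colE; last by move=> *; rewrite mxE.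
    by case: (nat_of_ord k) => //= k'; rewrite eG.
  split=> [/eqP|h].
    rewrite subr_eq0 => /eqP e i k hi; case: (ltnP k j.+1) => hk.
      have := congr1 (fun M => fun_of_matrix M (Ordinal hi) (Ordinal hk)) e.
      by rewrite e1 e2.
    rewrite entry_out_col ?(ltnW hk) //.
    by case: k hk => //= k hk; rewrite entry_out_col.
  apply/eqP; rewrite subr_eq0; apply/eqP/matrixP => i k.
  by rewrite e1 e2 h.
pose phi := @row_slice n.+1 j n 0 (j - n).
apply: (@ker_dim_eq F _ _ _ _ _ _ phi) => [Z /eqZ hZ phi0|t].
  have diagZ i k : (i <= n)%N ->
      entry Z (n - i) k = if (k < i)%N then 0 else entry Z n (k - i).
    elim: i k => [|i IH] k lei; first by rewrite !subn0.
    rewrite hZ; last by lia.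
    case: k => //= k; rewrite -subSn // subSS IH ?subSS //; exact: ltnW.
  have zero0 s : entry Z n s = 0.
    case: (ltnP s (j - n)) => hs.
      have := congr1 (fun v : 'rV_(j - n) => v 0 (Ordinal hs)) phi0.
      by rewrite !mxE /= addn0.
    have := diagZ n (n + s)%N (leqnn _); rewrite ltnNge leq_addr /= addKn => <-.
    by rewrite entry_out_col //; lia.
  apply/matrixP=> i k; rewrite mxE -entryE -(subKn (leq_ord i)) diagZ ?leq_subr //.
  by case: ltnP.
pose T i k := if (n - i <= k)%N then entry t 0 (k - (n - i)) else 0.
exists (\matrix_(i < n.+1, k < j) T i k).
  apply/eqZ => i k lti.
  have -> : shift_right (entry (\matrix_(i < n.+1, k < j) T i k) i.+1) k =
            if (k <= j)%N then shift_right (T i.+1) k else 0.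
    case: k => //= k; case: ltnP => hk; last by rewrite entry_out_col.
    by rewrite entry_mx.
  case: (ltnP k j) => hk.
    rewrite entry_mx ?(ltnW hk) //; last exact: ltnW.
    rewrite /T; case: k hk => [|k] hk /=; last by rewrite -subnSK // ltnS subSS.
    by rewrite -subnSK.
  rewrite entry_out_col //; case: ifP => // lek; case: k hk lek => //= k hk lek.
  rewrite /T; case: ifP => // _; rewrite entry_out_col //.
  by move: hk lek lti; lia.
apply/rowP=> s; rewrite mxE.
have ltj : (s < j)%N by have := ltn_ord s; lia.
by rewrite addn0 entry_mx // /T subnn leq0n subn0 (entryE t ord0 s).
Qed.

Lemma hom_dim_FG (b : kblock F) j : kblock_ok b ->
  hom_dim (kpencil b) (Fmx F j) (Gmx F j) =
  if b is KFG n then (j - n)%N else 0%N.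
Proof.
case: b => [n c|n|n|n] /= okb.
- by apply: hom_dim_FG0; left; rewrite row_free_unit unitmx_tr unitmx1.
- by apply: hom_dim_FG0; right; rewrite row_free_unit unitmx_tr unitmx1.
- exact: hom_dim_KFG_FG.
apply: hom_dim_FG0; left; rewrite /= trmxK.
by rewrite -[Fmx _ _]scale1r -[_ *: _]addr0 -(scale0r (Gmx F n)) FG_comb_row_free // oner_neq0.
Qed.
End ProbeValues.

(** * Multiplicities of blocks from second differences *)

Section Counting.
Variable F : fieldType.
Implicit Types K : seq (kblock F).

(** As a function of [j], [minn m j] is linear except for a bend at [j = m], so its second
    difference at [n] singles out the blocks of size [n]. *)
Lemma hom_dim_count_jordan K n a : all (@kblock_ok F) K -> (0 < n)%N ->
  let h j := hom_dim (ksum K) (jordan j a) 1%:M in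
  (2 * h n = h n.-1 + h n.+1 + count_mem (KJordan n a) K)%N.
Proof.
move=> okK n_gt0 /=; rewrite !hom_dim_ksum.
elim: K okK => [|b K IH]; first by rewrite !big_nil.
case/andP=> okb okK; rewrite !big_cons !hom_dim_jordan // mulnDr IH //= {IH}.
set c := count_mem _ _; set s1 := (\sum_(_ <- _) _)%N; set s2 := (\sum_(_ <- _) _)%N.
case: b okb => [m e|m|m|m] /= _; try lia.
have -> : (KJordan m e == KJordan n a) = (m == n) && (e == a).
  by apply/eqP/andP => [[-> ->]|[/eqP-> /eqP->]]; rewrite ?eqxx.
case: eqP => _; rewrite ?andbF /=; last by lia.
by case: eqP => [->|] /=; lia.
Qed.

Lemma hom_dim_count_FG K n : all (@kblock_ok F) K ->
  let h j := hom_dim (ksum K) (Fmx F j) (Gmx F j) in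
  (h n.-1 + h n.+1 = 2 * h n + count_mem (KFG F n) K)%N.
Proof.
move=> okK /=; rewrite !hom_dim_ksum.
elim: K okK => [|b K IH]; first by rewrite !big_nil.
case/andP=> okb okK; rewrite !big_cons !hom_dim_FG // mulnDr /=.
move: (IH okK) => {IH}.
set c := count_mem _ _; set s1 := (\sum_(_ <- _) _)%N; set s2 := (\sum_(_ <- _) _)%N.
set s3 := (\sum_(_ <- _) _)%N.
case: b okb => [m e|m|m|m] /= _; try lia.
have -> : (KFG F m == KFG F n) = (m == n) by apply/eqP/eqP => [[]|->].
by case: eqP => [->|] /=; lia.
Qed.

Lemma count_jordan_iso K K' n a : all (@kblock_ok F) K -> all (@kblock_ok F) K' ->
  ksum K =~ ksum K' -> (0 < n)%N ->
  count_mem (KJordan n a) K = count_mem (KJordan n a) K'.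
Proof.
move=> okK okK' iso n_gt0.
have := hom_dim_count_jordan a okK n_gt0; have := hom_dim_count_jordan a okK' n_gt0.
by rewrite /= !(hom_dim_iso _ _ iso); lia.
Qed.

Lemma count_FG_iso K K' n : all (@kblock_ok F) K -> all (@kblock_ok F) K' ->
  ksum K =~ ksum K' -> count_mem (KFG F n) K = count_mem (KFG F n) K'.
Proof.
move=> okK okK' iso.
have := hom_dim_count_FG n okK; have := hom_dim_count_FG n okK'.
by rewrite /= !(hom_dim_iso _ _ iso); lia.
Qed.

End Counting.

(** * Parity of the multiplicities for eigenvalues 1 and -1 *)
Section Parity.
Variable F : fieldType.
Hypothesis two_neq0 : 2%:R != 0 :> F.

Lemma skew_unit_even n (M : 'M[F]_n) : M^T = - M -> M \in unitmx -> ~~ odd n.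
Proof.
move=> skewM; rewrite unitmxE unitfE => nz; apply: contra nz => odd_n.
have := congr1 (fun N : 'M_n => \det N) skewM.
rewrite det_tr -scaleN1r detZ -signr_odd odd_n expr1 mulN1r => /eqP.
by rewrite -subr_eq0 opprK -mulr2n -mulr_natl mulf_eq0 (negPf two_neq0).
Qed.

(** For a rank factorization M = C R and a left inverse U of C, the matrix R U^T = U M U^T is skew,
    and it is invertible of size the rank of M. *)
Lemma skew_rank_even n (M : 'M[F]_n) : M^T = - M -> ~~ odd (\rank M).
Proof.
move=> skewM; set C := col_base M; set R := row_base M.
have /row_fullP[U UC] : row_full C by apply: col_base_full.
have MCR : M = C *m R by rewrite /C /R mulmx_base.
have UM : U *m M = R by rewrite (congr1 (mulmx U) MCR) mulmxA UC mul1mx.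
apply: (@skew_unit_even _ (R *m U^T)).
  by rewrite trmx_mul trmxK -UM trmx_mul skewM mulNmx mulmxN mulmxA.
rewrite -row_free_unit /row_free eqn_leq rank_leq_row /=.
apply: leq_trans (mxrankM_maxr C _).
have -> // : \rank (C *m (R *m U^T)) = \rank M.
rewrite mulmxA -MCR -mxrank_tr trmx_mul trmxK skewM mulmxN UM eqmx_opp.
by rewrite /R eq_row_base.
Qed.

Lemma mxvec_mul_tr m n (Y Z : 'M[F]_(m, n)) :
  mxvec Y *m (mxvec Z)^T = (\tr (Y^T *m Z))%:M.
Proof.
apply/matrixP=> i j; rewrite !ord1 !mxE eqxx mulr1n.
rewrite (reindex _ (curry_mxvec_bij _ _)) /=.
under eq_bigr do rewrite mxE.
rewrite (eq_bigr (fun p => Y p.1 p.2 * Z p.1 p.2)); last first.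
  by case=> k l _; rewrite /= !mxvecE.
rewrite -(pair_bigA _ (fun k l => Y k l * Z k l)) /= exchange_big /=.
by apply: eq_bigr => l _; rewrite mxE; apply: eq_bigr => k _; rewrite mxE.
Qed.

(* If [J = E^T E^-1] is itself a cosquare, the equation A^T Z J = A Z becomes
   degeneracy of an alternating form in Z. *)
Lemma hom_dim_cosquare_even n j (A : 'M[F]_n) (J E : 'M[F]_j) :
  E \in unitmx -> E^T = J *m E ->
  ~~ odd (n * j + hom_dim (Pencil A^T A) J 1%:M).
Proof.
(* Since J E = E^T, the map [g] sends Z to A^T Z E^T - A Z E, which is skew for the trace form and
   has the same kernel as the original map. *)
move=> uE tE; pose g := mulmxr E \o sylv A^T A J 1%:M.
have tJE : E^T *m J^T = E by rewrite -trmx_mul -tE trmxK.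
have kg : ker_dim g = hom_dim (Pencil A^T A) J 1%:M.
  apply/eqP; rewrite eqn_leq /hom_dim /=.
  apply/andP; split; apply: (@ker_dim_le _ _ _ _ _ _ _ _ _ _ _ idfun) => Z //= hZ.
    by move: hZ => /(congr1 (mulmx^~ (invmx E))); rewrite mulmxK // mul0mx.
  by rewrite [sylv _ _ _ _ Z]hZ mul0mx.
have trE (Y Z : 'M[F]_(n, j)) : \tr ((g Y)^T *m Z) =
    \tr (E *m Y^T *m A *m Z) - \tr (E^T *m Y^T *m A^T *m Z).
  rewrite /g /= /sylv mulmx1 mulmxBl raddfB /= mulmxBl raddfB /= !trmx_mul trmxK.
  by rewrite !mulmxA tJE.
have skew : (lin_mx g)^T = - lin_mx g.
  have H Y Z : mxvec Y *m lin_mx g *m (mxvec Z)^T = - (mxvec Z *m lin_mx g *m (mxvec Y)^T).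
    rewrite !mul_vec_lin !mxvec_mul_tr -raddfN /=; congr (_%:M).
    by rewrite !trE opprB; congr (_ - _);
      rewrite -mxtrace_tr !trmx_mul !trmxK !mulmxA mxtrace_mulC !mulmxA.
  apply/matrixP=> a b; rewrite mxE [RHS]mxE.
  have := H (vec_mx (delta_mx 0 b)) (vec_mx (delta_mx 0 a)).
  rewrite !vec_mxK -!rowE !trmx_delta -!colE => /matrixP/(_ 0 0).
  by rewrite !mxE.
have := skew_rank_even skew; have := mxrank_ker (lin_mx g); have := rank_leq_row (lin_mx g).
rewrite -[X in _ -> X = _ -> _]/(ker_dim g) kg.
set k := hom_dim _ _ _; set r := \rank _; set N := (n * j)%N => leN ->.
by lia.
Qed.

(** In the second difference at [m], the values at m - 1 and m + 1 are congruent modulo 2 to n(m -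
    1) and n(m + 1), hence to each other. So the multiplicity is even. *)
Lemma count_jordan_even n (A : 'M[F]_n) K m (c : F) :
    (forall j, (j == m.-1) || (j == m.+1) ->
      exists2 E : 'M[F]_j, E \in unitmx & E^T = jordan j c *m E) ->
    all (@kblock_ok F) K -> Pencil A^T A =~ ksum K -> (0 < m)%N ->
  ~~ odd (count_mem (KJordan m c) K).
Proof.
move=> hE okK hK m_gt0.
have := hom_dim_count_jordan c okK m_gt0; rewrite /= -!(hom_dim_iso _ _ hK).
have [|E1 uE1 tE1] := hE m.-1; first by rewrite eqxx.
have [|E2 uE2 tE2] := hE m.+1; first by rewrite eqxx orbT.
have := hom_dim_cosquare_even A uE1 tE1; have := hom_dim_cosquare_even A uE2 tE2.
set h1 := hom_dim _ _ _; set h2 := hom_dim _ _ _; set h := hom_dim _ _ _.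
move=> e1 e2 e.
have odd_eq : odd (h2 + h1 + count_mem (KJordan m c) K) = false.
  by rewrite -e mul2n odd_double.
move: e1 e2 odd_eq; rewrite !oddD !oddM.
have -> : odd m.+1 = odd m.-1 by case: (m) m_gt0 => //= m' _; rewrite negbK.
by do 5!case: (odd _).
Qed.

End Parity.

(** * Equivalence of (A^T, A) implies congruence *)
Section Congruence.
Variable F : closedFieldType.
Hypothesis two_neq0 : 2%:R != 0 :> F.

Lemma closed_sqrt (a : F) : exists r, r ^+ 2 = a.
Proof.
have [r] := @solve_monicpoly F 2 (fun i => if i == 0%N then a else 0) isT.
by rewrite !big_ord_recl big_ord0 /= mul0r !addr0 expr0 mulr1 => rE; exists r.
Qed.

(* Newton's correction [f + c q] when [a] is already a root of [q], and
   interpolation at [a] otherwise. *)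
Lemma poly_sqrt_mod (s : seq F) : 0 \notin s ->
  exists f : {poly F}, \prod_(a <- s) ('X - a%:P) %| f ^+ 2 - 'X.
Proof.
elim: s => [|a s IH]; first by exists 0; rewrite big_nil dvd1p.
rewrite inE negb_or eq_sym => /andP[nz_a /IH[f]].
rewrite big_cons; set q := \prod_(_ <- _) _ => /dvdpP[h defh].
(* From f^2 - X = h q one gets (f + c q)^2 - X = q (h + 2 c f + c^2 q), so it suffices that the last
   factor vanishes at [a]. *)
have step c : (h + c%:P * (2%:R * f) + c%:P ^+ 2 * q).[a] = 0 ->
    exists f : {poly F}, ('X - a%:P) * q %| f ^+ 2 - 'X.
  move=> /eqP/factor_theorem[g defg]; exists (f + c%:P * q).
  apply/dvdpP; exists g.
  have -> : g * (('X - a%:P) * q) = q * (g * ('X - a%:P)) by ring.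
  rewrite -defg.
  have -> : (f + c%:P * q) ^+ 2 - 'X = (f ^+ 2 - 'X) + q * (c%:P * (2%:R * f) + c%:P ^+ 2 * q).
    by ring.
  by rewrite defh; ring.
have eq_at : f.[a] ^+ 2 - a = h.[a] * q.[a].
  by have := congr1 (horner^~ a) defh; rewrite /= !hornerE.
have [qa0|nz_qa] := eqVneq q.[a] 0.
  have nz_fa : f.[a] != 0.
    apply: contra nz_a => /eqP fa0; move: eq_at; rewrite qa0 fa0 mulr0 expr0n /= sub0r.
    by move/eqP; rewrite oppr_eq0.
  apply: (step (- h.[a] / (2%:R * f.[a]))).
  have e2 : (2%:R : {poly F}).[a] = 2%:R by rewrite -polyC_natr hornerC.
  rewrite !hornerD !hornerM !hornerC e2 qa0 mulr0 addr0 divfK ?mulf_neq0 //.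
  by rewrite subrr.
have [r defr] := closed_sqrt a.
apply: (step ((r - f.[a]) / q.[a])).
have e2 : (2%:R : {poly F}).[a] = 2%:R by rewrite -polyC_natr hornerC.
rewrite !(hornerM, horner_exp, hornerC, e2, hornerD); apply: (mulfI nz_qa).
rewrite mulr0 2!mulrDr [q.[a] * h.[a]]mulrC -eq_at.
move: (q.[a]) (f.[a]) nz_qa => qa fa nz_qa; rewrite -defr.
by field.
Qed.

(** The root is f(P), where f^2 - X is a multiple of the characteristic polynomial. Such an f exists
    because 0 is not an eigenvalue, and f(P) inherits the relation with [A] by induction on f. *)
Lemma matrix_sqrt n (P : 'M[F]_n) : P \in unitmx ->
  exists2 Q : 'M_n, Q *m Q = P &
    forall A : 'M_n, P *m A = A *m P^T -> Q *m A = A *m Q^T.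
Proof.
case: n P => [|n] P uP.
  by exists P => [|A _]; apply/matrixP=> [[]].
have [s defs] := closed_field_poly_normal (char_poly P).
rewrite (monicP (char_poly_monic P)) scale1r in defs.
have s0 : 0 \notin s.
  apply/negP; rewrite -root_prod_XsubC -defs -eigenvalue_root_char.
  case/eigenvalueP=> v; rewrite scale0r => vP0; apply/negP; rewrite negbK.
  by rewrite -[v](mulmxK uP) vP0 mul0mx.
have [f] := poly_sqrt_mod s0; rewrite -defs => /dvdpP[h defh].
exists (horner_mx P f).
  have := congr1 (horner_mx P) defh.
  rewrite rmorphM /= Cayley_Hamilton mulr0 rmorphB rmorphXn /= horner_mx_X.
  by move/eqP; rewrite subr_eq0 expr2 => /eqP.
move=> A PA.
elim/poly_ind: f {h defh} => [|p c IH].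
  by rewrite rmorph0 mul0mx trmx0 mulmx0.
rewrite rmorphD rmorphM /= horner_mx_X horner_mx_C linearD /= tr_scalar_mx.
rewrite -mulmxE trmx_mul mulmxDl mulmxDr mul_scalar_mx mul_mx_scalar.
congr (_ + _); rewrite -mulmxA PA mulmxA IH -mulmxA; congr (_ *m _).
rewrite -!trmx_mul; congr (_^T).
exact: (comm_mx_horner p (erefl : comm_mx P P)).
Qed.

Lemma congruent_of_iso n (A B : 'M[F]_n) :
  Pencil A^T A =~ Pencil B^T B -> congruent A B.
Proof.
move=> /pair_equiv_iso[R [S [uR uS eAt eA]]].
have eA' : S^T *m A *m R^T = B by rewrite -[B]trmxK -eAt !trmx_mul !trmxK mulmxA.
have uSt : S^T \in unitmx by rewrite unitmx_tr.
pose P := invmx S^T *m R.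
have uP : P \in unitmx by rewrite unitmx_mul unitmx_inv uSt.
have PA : P *m A = A *m P^T.
  rewrite /P trmx_mul trmx_inv trmxK -mulmxA; apply: (canLR (mulKmx uSt)).
  by rewrite !mulmxA; apply: (canRL (mulmxK uS)); rewrite eA eA'.
have [Q QQ commQ] := matrix_sqrt uP.
(* For T = Q^T S one has T^T A T = S^T Q A Q^T S = S^T Q Q A S = S^T P A S = R A S = B. *)
exists (Q^T *m S).
  rewrite unitmx_mul uS andbT unitmx_tr.
  by move: uP; rewrite -QQ unitmx_mul andbb.
rewrite trmx_mul trmxK !mulmxA -(mulmxA _ A) -(commQ _ PA) !mulmxA.
by rewrite -(mulmxA S^T Q) QQ /P mulKVmx.
Qed.

End Congruence.

(** * Kronecker forms of the tridiagonal blocks *)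
Section Recognition.
Variable F : closedFieldType.
Implicit Types K : seq (kblock F).

Lemma block_diag_row_free m n p q (A : 'M[F]_(m, n)) (B : 'M_(p, q)) :
  row_free (block_mx A 0 0 B) = row_free A && row_free B.
Proof.
rewrite /row_free rank_diag_block_mx.
by have := rank_leq_row A; have := rank_leq_row B; lia.
Qed.

Lemma row_free_ksum K x y :
  row_free (x *: dsum (@kfst F) K + y *: dsum (@ksnd F) K) =
  all (fun b => row_free (x *: kfst b + y *: ksnd b)) K.
Proof.
elim: K => [|b K IH] /=; first by rewrite /row_free -leqn0 rank_leq_row.
by rewrite !scale_block_mx add_block_mx !scaler0 !addr0 block_diag_row_free IH.
Qed.

Lemma jordan0_not_row_free n : (0 < n)%N -> ~~ row_free (jordan n (0 : F)).
Proof.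
case: n => // n _; rewrite row_free_unit unitmxE (_ : \det _ = 0) ?unitr0 //.
rewrite -det_tr det_trig; last first.
  apply/is_trig_mxP => i j ij; rewrite mxE jordan0E.
  by rewrite ltn_eqF // ltnS ltnW.
by rewrite (bigD1 ord0) //= mxE jordan0E mul0r.
Qed.

Lemma tall_not_row_free n (M : 'M[F]_(n.+1, n)) : ~~ row_free M.
Proof. by apply/negP => /eqP h; have := rank_leq_col M; rewrite h ltnn. Qed.

Lemma row_free_comb_iso m n (A B : 'M[F]_(m, n)) K x y : Pencil A B =~ ksum K ->
  row_free (x *: A + y *: B) = all (fun b => row_free (x *: kfst b + y *: ksnd b)) K.
Proof. by move=> /(iso_comb x y 0 0)/row_free_iso /= ->; apply: row_free_ksum. Qed.

Lemma hom_dim_le1 n (A B : 'M[F]_n) c i0 :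
  (forall v : 'cV_n, (B - c *: A) *m v = 0 -> v i0 0 = 0 -> v = 0) ->
  (hom_dim (Pencil A B) (jordan 1 c) 1%:M <= 1)%N.
Proof.
move=> h; rewrite /hom_dim -(@ker_dim_image F _ _ _ _ _ _ _ (@row_slice F n 1 i0 0 1)) /=.
  exact: leq_trans (rank_leq_col _) _.
move=> Z /eqP; rewrite subr_eq0 => /eqP /hom_eq_nilpotent eqZ /rowP/(_ 0).
rewrite !mxE (entryE Z i0 0); apply: h; rewrite eqZ.
by apply/matrixP=> i j; rewrite mxE big1 ?mxE // => l _; rewrite jordan0E !ord1 mulr0.
Qed.

Lemma sum_nat_eq0P (T : eqType) (s : seq T) (f : T -> nat) :
  (\sum_(t <- s) f t = 0)%N -> forall t, t \in s -> f t = 0%N.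
Proof.
elim: s => // t s IH; rewrite big_cons => /eqP; rewrite addn_eq0.
by move=> /andP[/eqP ft /eqP/IH fs] u; rewrite inE => /orP[/eqP->|/fs].
Qed.

(** In a Kronecker form, the first two hypotheses leave only Jordan blocks with eigenvalue [c]. By
    the third, the kernel of [B - c *: A] is at most a line, so there is one block. *)
Lemma recognize_jordan n (A B : 'M[F]_n) c i0 :
    A \in unitmx -> (forall a, a != c -> B - a *: A \in unitmx) ->
    (forall v : 'cV_n, (B - c *: A) *m v = 0 -> v i0 0 = 0 -> v = 0) ->
  Pencil A B =~ kpencil (KJordan n c).
Proof.
move=> uA uB h1; have [K okK hK] := kronecker_exists (Pencil A B).
have fA : all (fun b => row_free (1 *: kfst b + 0 *: ksnd b)) K.
  by rewrite -(row_free_comb_iso _ _ hK) scale1r scale0r addr0 row_free_unit.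
have noB a : a != c -> forall b, b \in K -> hom_dim (kpencil b) (jordan 1 a) 1%:M = 0%N.
  move=> ac; apply: sum_nat_eq0P; rewrite -hom_dim_ksum -(hom_dim_iso _ _ hK).
  by apply: hom_dim_jordan0; rewrite row_free_unit unitmx_tr uB.
have allJ b : b \in K -> exists m, b = KJordan m c.
  move=> bK; have okb := allP okK _ bK; have := allP fA _ bK.
  rewrite scale1r scale0r addr0; have := noB _ _ _ bK.
  case: b okb bK => [m a|m|m|m] /= okb bK hb.
  - case: (eqVneq a c) => [->|ac]; first by exists m.
    by have := hb a ac; rewrite hom_dim_jordan // eqxx; lia.
  - by rewrite (negPf (jordan0_not_row_free okb)).
  (* A block (F_m, G_m) would have a nonzero invariant at every eigenvalue; [c + 1] is one different
     from [c]. *)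
  - have := hb (c + 1); rewrite hom_dim_jordan //= => h _.
    by have := h _; rewrite -subr_eq0 addrAC subrr add0r oner_neq0 => /(_ isT).
  by rewrite (negPf (tall_not_row_free _)).
have : (size K <= 1)%N.
  apply: leq_trans (hom_dim_le1 h1); rewrite (hom_dim_iso _ _ hK) hom_dim_ksum.
  rewrite -sum1_size !big_seq; apply: leq_sum => b bK; have [m eb] := allJ b bK.
  rewrite hom_dim_jordan ?(allP okK) // eb eqxx.
  by have := allP okK _ bK; rewrite eb /=; lia.
have [/= en _] := iso_dim hK.
case: K {okK fA noB} allJ hK en => [|b [|//]] allJ hK en _.
  by have := ltn_ord i0; rewrite {2}en.
have [m eb] := allJ b (mem_head _ _); subst b; move: en => /=; rewrite addn0 => en.
by subst m; apply: iso_trans hK (ksum1 _).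
Qed.

(** Every other kind of block has a nonzero combination of its two matrices that is not of full row
    rank. The excess of columns over rows then counts the blocks (F_k, G_k). *)
Lemma recognize_FG m (A B : 'M[F]_(m, m.+1)) :
    (forall x y, (x != 0) || (y != 0) -> row_free (x *: A + y *: B)) ->
  Pencil A B =~ kpencil (KFG F m).
Proof.
move=> free; have [K okK hK] := kronecker_exists (Pencil A B).
have freeK x y : (x != 0) || (y != 0) ->
    all (fun b => row_free (x *: kfst b + y *: ksnd b)) K.
  by move=> nz; rewrite -(row_free_comb_iso _ _ hK) free.
have allF b : b \in K -> exists k, b = KFG F k.
  move=> bK; have okb := allP okK _ bK.
  case: b okb bK => [k a|k|k|k] /= okb bK.
  - have /allP/(_ _ bK) : all (fun b => row_free (- a *: kfst b + 1 *: ksnd b)) K.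
      by apply: freeK; rewrite oner_neq0 orbT.
    rewrite /= scale1r scalemx1 jordan_diag0 addrA -raddfD addNr raddf0 add0r.
    by rewrite (negPf (jordan0_not_row_free okb)).
  - have /allP/(_ _ bK) : all (fun b => row_free (1 *: kfst b + 0 *: ksnd b)) K.
      by apply: freeK; rewrite oner_neq0.
    by rewrite /= scale1r scale0r addr0 (negPf (jordan0_not_row_free okb)).
  - by exists k.
  have /allP/(_ _ bK) : all (fun b => row_free (1 *: kfst b + 0 *: ksnd b)) K.
    by apply: freeK; rewrite oner_neq0.
  by rewrite /= (negPf (tall_not_row_free _)).
have [/= em en] := iso_dim hK.
have dimK : sumn (map (@kcols F) K) = (sumn (map (@krows F) K) + size K)%N.
  elim: K allF {okK hK freeK em en} => //= b K IH allF.
  have [k ->] := allF b (mem_head _ _); rewrite IH /=; first lia.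
  by move=> b' b'K; apply: allF; rewrite inE b'K orbT.
case: K {okK freeK} allF hK em en dimK => [|b [|b2 K]] /= allF hK em en dimK; try lia.
have [k eb] := allF b (mem_head _ _); subst b; rewrite /= addn0 in em.
by subst k; apply: iso_trans hK (ksum1 _).
Qed.

(** Row and column permutations are given as functions on natural numbers with their inverses, so
    they can be written as arithmetic formulas. *)
Lemma iso_reindex m n m' n' (A B : 'M[F]_(m, n)) (A' B' : 'M_(m', n'))
    (fr gr fc gc : nat -> nat) :
    (forall i, (i < m')%N -> (fr i < m)%N /\ gr (fr i) = i) ->
    (forall i, (i < m)%N -> (gr i < m')%N /\ fr (gr i) = i) ->
    (forall i, (i < n')%N -> (fc i < n)%N /\ gc (fc i) = i) ->
    (forall i, (i < n)%N -> (gc i < n')%N /\ fc (gc i) = i) ->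
    (forall (i' : 'I_m') (j' : 'I_n') (i : 'I_m) (j : 'I_n),
       i = fr i' :> nat -> j = fc j' :> nat ->
       A i j = A' i' j' /\ B i j = B' i' j') ->
  Pencil A B =~ Pencil A' B'.
Proof.
move=> hfr hgr hfc hgc eqAB.
pose FR (i : 'I_m') : 'I_m := Ordinal (hfr i (ltn_ord i)).1.
pose GR (i : 'I_m) : 'I_m' := Ordinal (hgr i (ltn_ord i)).1.
pose FC (i : 'I_n') : 'I_n := Ordinal (hfc i (ltn_ord i)).1.
pose GC (i : 'I_n) : 'I_n' := Ordinal (hgc i (ltn_ord i)).1.
exists (rowsub FR 1%:M), (rowsub GR 1%:M), (colsub FC 1%:M), (colsub GC 1%:M).
split.
- split; rewrite mul_rowsub_mx mul1mx; apply/matrixP=> i j; rewrite !mxE; congr ((_ : bool)%:R).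
    by apply/eqP/eqP => [<-|->]; apply: val_inj => /=; rewrite (hfr _ _).2.
  by apply/eqP/eqP => [<-|->]; apply: val_inj => /=; rewrite (hgr _ _).2.
- split; rewrite mulmx_colsub mulmx1; apply/matrixP=> i j; rewrite !mxE; congr ((_ : bool)%:R).
    by apply/eqP/eqP => [->|->]; apply: val_inj => /=; rewrite (hgc _ _).2.
  by apply/eqP/eqP => [->|->]; apply: val_inj => /=; rewrite (hfc _ _).2.
- rewrite /= mul_rowsub_mx mul1mx mulmx_colsub mulmx1.
  by apply/matrixP=> i j; rewrite !mxE; have [] := eqAB i j (FR i) (FC j) erefl erefl.
rewrite /= mul_rowsub_mx mul1mx mulmx_colsub mulmx1.
by apply/matrixP=> i j; rewrite !mxE; have [] := eqAB i j (FR i) (FC j) erefl erefl.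
Qed.

End Recognition.

(** * Tridiagonal matrices with zero diagonal *)

Section Tridiagonal.
Variable F : closedFieldType.

Lemma tridiagE n (c : F) (sub : nat -> F) (i j : 'I_n) : tridiag n c sub i j =
  if (i == 0 :> nat) && (j == 0 :> nat) then c
  else if j == i.+1 :> nat then 1 else if i == j.+1 :> nat then sub j else 0.
Proof. by rewrite mxE. Qed.

(* The rows of odd index and the columns of even index of a tridiagonal matrix
   with zero diagonal span an upper bidiagonal block. *)
Definition bidiag p q (a b : F) : 'M[F]_(p, q) :=
  \matrix_(i, j) (a *+ (j == i :> nat) + b *+ (j == i.+1 :> nat)).

(** Nonzero entries join indices of opposite parity, so the [p] odd rows meet only the [q] even
    columns, and the even rows only the odd columns. Transposing the matrix exchanges these two
    parts, whence the second is the first one swapped and transposed. *)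
Lemma tridiag_split p q n (x y : F) (sub : nat -> F) :
    (p + q = n)%N -> (p <= q <= p.+1)%N ->
    (forall j, sub j = if odd j then y else x) ->
  let D := Pencil (bidiag p q 1 y) (bidiag p q x 1) in
  Pencil (tridiag n 0 sub)^T (tridiag n 0 sub) =~ D :+: ptr (pswap D).
Proof.
move=> en pq subE.
apply: (@iso_reindex F _ _ _ _ _ _ _ _
  (fun i => if i < p then i.*2.+1 else (i - p).*2)%N
  (fun i => if odd i then i./2 else p + i./2)%N
  (fun i => if i < q then i.*2 else (i - q).*2.+1)%N
  (fun i => if odd i then q + i./2 else i./2)%N).
- move=> i /= hi; case: (ltnP i p) => h; rewrite /= ?odd_double /= ?uphalf_double ?doubleK; lia.
- move=> i /= hi; have := odd_double_half i; case: (odd i) => /= h.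
    by case: (ltnP i./2 p); lia.
  by case: (ltnP (p + i./2) p); lia.
- move=> i /= hi; case: (ltnP i q) => h; rewrite /= ?odd_double /= ?uphalf_double ?doubleK; lia.
- move=> i /= hi; have := odd_double_half i; case: (odd i) => /= h.
    by case: (ltnP (q + i./2) q); lia.
  by case: (ltnP i./2 q); lia.
move=> i' j' i j ei ej.
have zero (i1 j1 : 'I_n) : (j1 == i1.+1 :> nat) = false -> (i1 == j1.+1 :> nat) = false ->
    tridiag n 0 sub i1 j1 = 0.
  by move=> e1 e2; rewrite tridiagE e1 e2; case: ifP.
have entry_eo (i1 j1 : 'I_n) (k : 'I_p) (l : 'I_q) : i1 = k.*2.+1 :> nat -> j1 = l.*2 :> nat ->
    tridiag n 0 sub i1 j1 = bidiag p q x 1 k l /\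
    tridiag n 0 sub j1 i1 = bidiag p q 1 y k l.
  move=> ei1 ej1; rewrite !tridiagE !mxE !subE ei1 ej1 /= !odd_double /= andbF.
  rewrite !eqSS (inj_eq double_inj).
  have -> : (l.*2 == k.*2.+2) = (l == k.+1 :> nat) by rewrite -doubleS (inj_eq double_inj).
  rewrite [k == l :> nat]eq_sym.
  case: eqP => [->|_] /=; first by rewrite gtn_eqF // !mulr0n !mulr1n !add0r.
  by case: eqP => _; rewrite ?mulr0n ?mulr1n ?addr0.
rewrite [(tridiag _ _ _)^T i j]mxE.
case: (fintype.split_ordP i') ei => k -> /= ei; case: (fintype.split_ordP j') ej => l -> /= ej.
- rewrite !block_mxEul.
  by have [-> ->] := entry_eo _ _ _ _ ei ej.
- rewrite !block_mxEur [X in _ = X /\ _]mxE [X in _ /\ _ = X]mxE.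
  rewrite ?ltnNge ?leq_addr /= ?addKn in ej.
  by split; apply: zero; rewrite ei ej; lia.
- rewrite !block_mxEdl [X in _ = X /\ _]mxE [X in _ /\ _ = X]mxE.
  rewrite ?ltnNge ?leq_addr /= ?addKn in ei.
  by split; apply: zero; rewrite ei ej; lia.
rewrite !block_mxEdr 2![_^T k l]mxE.
rewrite ?ltnNge ?leq_addr /= ?addKn in ei; rewrite ?ltnNge ?leq_addr /= ?addKn in ej.
by have [-> ->] := entry_eo _ _ _ _ ej ei.
Qed.

Lemma bidiag_square p (a b : F) : bidiag p p a b = a%:M + b *: jordan p 0.
Proof.
apply/matrixP=> i j; rewrite [RHS]mxE [X in _ = X + _]mxE [X in _ = _ + X]mxE jordan0E.
by rewrite mxE mulr_natr [j == i :> nat]eq_sym.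
Qed.

Lemma bidiag_wide p (a b : F) : bidiag p p.+1 a b = a *: Fmx F p + b *: Gmx F p.
Proof. by apply/matrixP=> i j; rewrite !mxE !mulr_natr. Qed.

Lemma bidiag_unit p (a b : F) : a != 0 -> bidiag p p a b \in unitmx.
Proof.
move=> nz_a; apply: upper_triangular_unit => [i j ij|i]; rewrite mxE.
  by rewrite (ltn_eqF ij) (ltn_eqF (ltnW ij : (j < i.+1)%N)) !mulr0n addr0.
by rewrite eqxx ltn_eqF // mulr0n addr0.
Qed.

Lemma bidiag_comb p q (a b c d x : F) :
  bidiag p q a b - x *: bidiag p q c d = bidiag p q (a - x * c) (b - x * d).
Proof. by apply/matrixP=> i j; rewrite !mxE; do 2!case: eqP => _ /=; ring. Qed.

Lemma bidiag_shift_inj n (b : F) (v : 'cV_n.+1) : b != 0 ->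
  bidiag n.+1 n.+1 0 b *m v = 0 -> v ord0 0 = 0 -> v = 0.
Proof.
move=> nz_b; rewrite bidiag_square raddf0 add0r -scalemxAl => /eqP.
rewrite scaler_eq0 (negPf nz_b) => /eqP Nv v0.
apply/colP=> i; rewrite mxE; case: (unliftP ord0 i) => [i' ->|-> //].
have := congr1 (fun M => fun_of_matrix M (widen_ord (leqnSn n) i') 0) Nv.
rewrite /= jordan0_mulE mxE; apply: etrans; apply/esym.
exact: (entryE v (lift ord0 i') 0).
Qed.

(** The combination of parameter [a] has diagonal x - a and superdiagonal 1 - a y. It is singular
    only for a = x, where it is a nonzero multiple of the nilpotent shift because x y is not 1. *)
Lemma bidiag_jordan k (x y : F) : (0 < k)%N -> x * y != 1 ->
  Pencil (bidiag k k 1 y) (bidiag k k x 1) =~ kpencil (KJordan k x).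
Proof.
case: k => // k _ xy1; apply: (recognize_jordan (i0 := ord0)).
- by apply: bidiag_unit; apply: oner_neq0.
- by move=> a ax; rewrite bidiag_comb bidiag_unit // mulr1 subr_eq0 eq_sym.
move=> v; rewrite bidiag_comb mulr1 subrr; apply: bidiag_shift_inj.
by rewrite subr_eq0 eq_sym.
Qed.

Lemma iso_swap_jordan k (x : F) : (0 < k)%N ->
  ptr (pswap (kpencil (KJordan k x))) =~ kpencil (KJordan_swap k x).
Proof.
move=> k_gt0; rewrite /KJordan_swap; case: eqP => [->|/eqP nz_x].
  exact: (iso_tr_block (KInfty F k)).
apply: iso_trans (iso_tr_block (KJordan k x^-1)); apply: iso_tr.
have -> : pswap (kpencil (KJordan k x)) = Pencil (bidiag k k x 1) (bidiag k k 1 0).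
  rewrite /pswap /kpencil /= !bidiag_square scale1r scale0r addr0.
  by rewrite -jordan_diag0.
case: k k_gt0 => // k _; apply: (recognize_jordan (i0 := ord0)).
- exact: bidiag_unit.
- move=> a ax; rewrite bidiag_comb bidiag_unit // subr_eq0.
  by apply: contra ax => /eqP e; rewrite eq_sym -(mulfK nz_x a) -e mul1r.
move=> v; rewrite bidiag_comb mulVf // subrr; apply: bidiag_shift_inj.
by rewrite mulr1 sub0r oppr_eq0 invr_neq0.
Qed.

(** A combination with coefficients a, b equals (a + b x) F + (a y + b) G. This linear change of
    coefficients has determinant 1 - x y, so it preserves being nonzero. *)
Lemma bidiag_FG k (x y : F) : x * y != 1 ->
  Pencil (bidiag k k.+1 1 y) (bidiag k k.+1 x 1) =~ kpencil (KFG F k).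
Proof.
move=> xy1; apply: recognize_FG => a b nz.
rewrite !bidiag_wide !scalerDr !scalerA addrACA -!scalerDl !mulr1.
apply: FG_comb_row_free; apply: contraTT nz; rewrite !negb_or !negbK.
case/andP=> /eqP e1 /eqP e2.
have ea : a = - (b * x) by apply/eqP; rewrite -subr_eq0 opprK e1.
have : b * (1 - x * y) = 0 by rewrite -[RHS]e2 ea; ring.
move/eqP; rewrite mulf_eq0 subr_eq0 [1 == _]eq_sym (negPf xy1) orbF => /eqP b0.
by rewrite ea b0 mul0r oppr0 eqxx.
Qed.

Lemma iso_swap_FG k : ptr (pswap (kpencil (KFG F k))) =~ kpencil (KFGtr F k).
Proof.
apply: iso_trans (iso_tr_block (KFG F k)); apply: iso_tr.
apply: recognize_FG => a b nz; rewrite addrC; apply: FG_comb_row_free.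
by rewrite orbC.
Qed.

Lemma ksum2 (b b' : kblock F) : kpencil b :+: kpencil b' =~ ksum [:: b; b'].
Proof. by rewrite ksum_cons; apply: iso_add (iso_refl _) (iso_sym (ksum1 _)). Qed.

Lemma tridiag_even k (x y : F) (sub : nat -> F) : (0 < k)%N -> x * y != 1 ->
    (forall j, sub j = if odd j then y else x) ->
  Pencil (tridiag (2 * k) 0 sub)^T (tridiag (2 * k) 0 sub) =~
  ksum [:: KJordan k x; KJordan_swap k x].
Proof.
move=> k_gt0 xy1 subE; apply: iso_trans (ksum2 _ _).
have hD := bidiag_jordan k_gt0 xy1.
apply: iso_trans (tridiag_split (p := k) (q := k) _ _ subE) _; [lia|lia|].
apply: iso_add (hD) _; apply: iso_trans (iso_swap_jordan _ k_gt0).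
exact: iso_tr (iso_swap hD).
Qed.

Lemma tridiag_odd k (x y : F) (sub : nat -> F) : x * y != 1 ->
    (forall j, sub j = if odd j then y else x) ->
  Pencil (tridiag (2 * k + 1) 0 sub)^T (tridiag (2 * k + 1) 0 sub) =~
  ksum [:: KFG F k; KFGtr F k].
Proof.
move=> xy1 subE; apply: iso_trans (ksum2 _ _).
have hD := bidiag_FG k xy1.
apply: iso_trans (tridiag_split (p := k) (q := k.+1) _ _ subE) _; [lia|lia|].
apply: iso_add (hD) _; apply: iso_trans (iso_swap_FG k).
exact: iso_tr (iso_swap hD).
Qed.
End Tridiagonal.

(** * The block of type (ii) with corner entry 1 *)

Section CornerBlock.
Variable F : closedFieldType.
Hypothesis two_neq0 : 2%:R != 0 :> F.

Definition alt_sign (j : nat) : F := if odd j then 1 else -1.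

Lemma alt_signE j : (-1) ^+ j.+1 = alt_sign j.
Proof. by rewrite -signr_odd /alt_sign /=; case: odd; rewrite ?expr0 ?expr1. Qed.

(* The equations (x B^T + y B) v = 0 for B of type (ii) with corner entry 1,
   the coordinates of v being w 0, ..., w (n - 1). *)
Definition corner_eqs n (x y : F) (w : nat -> F) :=
  [/\ forall i, (n <= i)%N -> w i = 0,
      (0 < n)%N -> (x + y) * w 0%N + (y - x) * w 1%N = 0,
      forall i, (i.+1 < n)%N -> ~~ odd i -> (x - y) * w i + (x + y) * w i.+2 = 0
    & forall i, (i.+1 < n)%N -> odd i -> (x + y) * w i + (y - x) * w i.+2 = 0].

Lemma type2_corner_eqs n (x y : F) (v : 'cV_n) :
  (x *: (type2_mx F n true)^T + y *: type2_mx F n true) *m v = 0 ->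
  corner_eqs n x y (entry v ^~ 0%N).
Proof.
move=> Mv.
(* Row [i] involves the coordinates i - 1 and i + 1 only, except that in row 0 the corner
   contributes the coordinate 0. *)
have row_eq i : (i < n)%N ->
    (if i is i'.+1 then (x + y * alt_sign i') * entry v i' 0 else (x + y) * entry v 0 0)
    + (y + x * alt_sign i) * entry v i.+1 0 = 0.
  move=> lti; have := congr1 (fun M => fun_of_matrix M (Ordinal lti) 0) Mv.
  rewrite [RHS]mxE => <-; rewrite mxE.
  have coef (l : 'I_n) : (x *: (type2_mx F n true)^T + y *: type2_mx F n true) (Ordinal lti) l =
      (if i is i'.+1 then (x + y * alt_sign i') * (l == i' :> nat)%:R
       else (x + y) * (l == 0%N :> nat)%:R) + (y + x * alt_sign i) * (l == i.+1 :> nat)%:R.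
    rewrite !mxE /= !alt_signE.
    case: i {lti} => [|i'] /=.
      case: (nat_of_ord l) => [|l'] /=; first by rewrite !mulr1 mulr0 addr0.
      case: l' => [|l'] /=; first by rewrite !mulr1 !mulr0 add0r addrC.
      by rewrite !mulr0.
    move: (nat_of_ord l) => m; rewrite !eqSS andbF [m == i']eq_sym.
    case: (eqVneq i' m) => [<-|ne1] /=.
      by rewrite (_ : (i' == i'.+2) = false) ?mulr1 ?mulr0 ?addr0 //; lia.
    by case: (m == i'.+2); rewrite !(mulr0, mulr1) !add0r // addrC.
  under eq_bigr do rewrite coef mulrDl.
  rewrite big_split /=; congr (_ + _).
    case: (i) lti coef => [|i'] lti coef.
      under eq_bigr do rewrite -mulrA; rewrite -mulr_sumr.
      by rewrite -(sum_entry_row v 0 0).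
    under eq_bigr do rewrite -mulrA; rewrite -mulr_sumr.
    by rewrite -(sum_entry_row v i' 0).
  under eq_bigr do rewrite -mulrA; rewrite -mulr_sumr.
  by rewrite -(sum_entry_row v i.+1 0).
split.
- by move=> i lei; rewrite entry_out_row.
- by move=> n_gt0; have := row_eq _ n_gt0; rewrite /alt_sign /= mulrN1.
- move=> i lti ei; have := row_eq _ lti; rewrite /alt_sign /= ei (negPf ei).
  by rewrite mulrN1 mulr1 [y + x]addrC.
move=> i lti oi; have := row_eq _ lti; rewrite /alt_sign /= oi /=.
by rewrite mulrN1 mulr1.
Qed.

(** The indices opposite in parity to n - 1 vanish downwards from the end. The equation of row 0
    carries this over to the first index of the other parity, and those indices vanish upwards. *)
Lemma corner_eqs_trivial n x y w : corner_eqs n x y w ->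
  (if odd n then x + y != 0 else x != y) -> forall i, w i = 0.
Proof.
move=> [w_out w_row0 w_even w_odd].
have cancel (a b c d : F) : a != 0 -> d = 0 -> a * b + c * d = 0 -> b = 0.
  by move=> nz_a -> /eqP; rewrite mulr0 addr0 mulf_eq0 (negPf nz_a) => /eqP.
have oddSS i : odd i.+2 = odd i by rewrite /= negbK.
case: ifP => [odd_n nz|even_n xy].
  have w_odd0 d i : odd i -> (n <= i + d)%N -> w i = 0.
    elim: d i => [|d IH] i oi le_i; first by apply: w_out; rewrite -[i]addn0.
    case: (leqP n i) => [/w_out //|lti].
    have lti1 : (i.+1 < n)%N.
      rewrite ltn_neqAle lti andbT; apply: contraTneq oi => e.
      by move: odd_n; rewrite -e.
    apply: cancel nz _ (w_odd i lti1 oi); apply: IH; [by rewrite oddSS|lia].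
  have w_odd1 i : odd i -> w i = 0 by move=> oi; apply: (w_odd0 n i oi); rewrite leq_addl.
  have w_even0 i : ~~ odd i -> w i = 0.
    have [m] := ubnP i; elim: m i => // m IH [|[|i]] // lti ei.
      by apply: cancel nz (w_odd1 1%N isT) (w_row0 _); case: (n) odd_n.
    rewrite oddSS in ei; case: (leqP n i.+2) => [/w_out //|lti2].
    have := w_even i (ltnW lti2) ei; rewrite addrC; apply: cancel nz _.
    by apply: IH => //; lia.
  by move=> i; case: (boolP (odd i)) => [/w_odd1|/w_even0].
have nz : x - y != 0 by rewrite subr_eq0.
have nz' : y - x != 0 by rewrite subr_eq0 eq_sym.
have w_even0 d i : ~~ odd i -> (n <= i + d)%N -> w i = 0.
  elim: d i => [|d IH] i oi le_i; first by apply: w_out; rewrite -[i]addn0.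
  case: (leqP n i) => [/w_out //|lti].
  have lti1 : (i.+1 < n)%N.
    rewrite ltn_neqAle lti andbT; apply: contraNneq oi => e.
    by move: even_n; rewrite -e /= => /negbFE.
  apply: cancel nz _ (w_even i lti1 oi); apply: IH; [by rewrite oddSS|lia].
have w_even1 i : ~~ odd i -> w i = 0 by move=> oi; apply: (w_even0 n i oi); rewrite leq_addl.
have w_odd0 i : odd i -> w i = 0.
  have [m] := ubnP i; elim: m i => // m IH [|[|i]] // lti oi.
    case: (posnP n) => [n0|n_gt0]; first by apply: w_out; rewrite n0.
    by have := w_row0 n_gt0; rewrite addrC; apply: cancel nz' (w_even1 0%N isT).
  rewrite oddSS in oi; case: (leqP n i.+2) => [/w_out //|lti2].
  have := w_odd i (ltnW lti2) oi; rewrite addrC; apply: cancel nz' _.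
  by apply: IH => //; lia.
by move=> i; case: (boolP (odd i)) => [/w_odd0|/w_even1].
Qed.

(** At this singular parameter one of the coefficients x + y and x - y is zero. Each equation then
    reduces to a single term, and together they kill every coordinate except the last. *)
Lemma corner_eqs_line n w :
    corner_eqs n (if odd n then -1 else 1) 1 w -> w n.-1 = 0 ->
  forall i, w i = 0.
Proof.
have cancel (b : F) : 2%:R * b = 0 -> b = 0.
  by move=> /eqP; rewrite mulf_eq0 (negPf two_neq0) => /eqP.
have two1 : 1 + 1 = 2%:R :> F by rewrite -mulr2n.
case: ifP => [odd_n|even_n] [w_out w_row0 w_even w_odd] w_last i.
  case: (leqP n i) => [/w_out //|lti].
  case: (boolP (odd i)) => oi.
    case: i lti oi => [|[|i]] // lti oi.
      have := w_row0 (ltnW lti).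
      by rewrite addNr mul0r add0r opprK two1; apply: cancel.
    have oi' : odd i by move: oi; rewrite /= negbK.
    have := w_odd i (ltnW lti) oi'.
    by rewrite addNr mul0r add0r opprK two1; apply: cancel.
  case: (ltnP i.+1 n) => [lti1|le_n].
    have := w_even i lti1 oi; rewrite addNr mul0r addr0 -opprD two1 mulNr.
    by move/eqP; rewrite oppr_eq0 => /eqP; apply: cancel.
  by rewrite -w_last; congr w; lia.
case: (leqP n i) => [/w_out //|lti].
case: (boolP (odd i)) => oi.
  case: (ltnP i.+1 n) => [lti1|le_n].
    have := w_odd i lti1 oi; rewrite subrr mul0r addr0 two1.
    exact: cancel.
  by rewrite -w_last; congr w; lia.
case: i lti oi => [|[|i]] // lti oi.
  by have := w_row0 lti; rewrite subrr mul0r addr0 two1; apply: cancel.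
have oi' : ~~ odd i by move: oi; rewrite /= negbK.
have := w_even i (ltnW lti) oi'.
by rewrite subrr mul0r add0r two1; apply: cancel.
Qed.

Lemma type2_corner_iso n : (0 < n)%N ->
  Pencil (type2_mx F n true)^T (type2_mx F n true) =~
  kpencil (KJordan n ((-1) ^+ n.+1)).
Proof.
move=> n_gt0; set B := type2_mx F n true.
have ltn1 : (n.-1 < n)%N by rewrite prednK.
have nz2 : (1 + 1 : F) != 0 by rewrite -mulr2n.
have zero_entries (v : 'cV[F]_n) : (forall i, entry v i 0 = 0) -> v = 0.
  by move=> h; apply/colP=> i; rewrite mxE -(entryE v i 0).
have unit_comb x y : (if odd n then x + y != 0 else x != y) ->
    x *: B^T + y *: B \in unitmx.
  move=> xy; rewrite -unitmx_tr -row_free_unit; apply: inj_row_free => v.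
  move/(congr1 trmx); rewrite trmx_mul trmxK trmx0 => /type2_corner_eqs eqs.
  apply: trmx_inj; rewrite trmx0; apply: zero_entries.
  exact: corner_eqs_trivial eqs xy.
rewrite alt_signE; apply: (recognize_jordan (i0 := Ordinal ltn1)).
- have := unit_comb 1 0; rewrite scale1r scale0r (addr0 B^T); apply.
  by case: ifP => _; rewrite ?addr0 oner_neq0.
- move=> a ac; have := unit_comb (- a) 1; rewrite scale1r scaleNr (addrC _ B); apply.
  move: ac; rewrite /alt_sign; case: odd => ac; last by rewrite eqr_oppLR.
  by rewrite addrC subr_eq0 eq_sym.
move=> v Mv v0; apply: zero_entries.
apply: (@corner_eqs_line n) => [|/=].
  apply: type2_corner_eqs; rewrite -[RHS]Mv -/B addrC scale1r; congr ((_ + _) *m _).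
  by rewrite /alt_sign; case: odd; rewrite ?scale1r ?scaleN1r ?opprK.
by have := entryE v (Ordinal ltn1) 0; rewrite v0.
Qed.
End CornerBlock.

(** * Balanced Kronecker forms *)
Section Classification.
Variable F : closedFieldType.
Hypothesis two_neq0 : 2%:R != 0 :> F.
Implicit Types (K : seq (kblock F)) (s : seq (tblock F)).

Lemma one_neqN1 : (1 : F) != -1.
Proof. by rewrite -subr_eq0 opprK -mulr2n. Qed.

(** The pencil of the corner block B is (I, J), say R B^T S = 1 and R B S = J. Then E = R B^T R^T
    works, because S R B^T = 1 gives J E = R B R^T = E^T. *)
Lemma jordan_cosquare j (c : F) : c = (-1) ^+ j.+1 ->
  exists2 E : 'M[F]_j, E \in unitmx & E^T = jordan j c *m E.
Proof.
move=> ->; have [j0|j_gt0] := posnP j.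
  subst j; exists 1%:M; first exact: unitmx1.
  by apply/matrixP=> [[]].
have := type2_corner_iso two_neq0 j_gt0; set B := type2_mx F j true.
move=> /pair_equiv_iso[R [S [uR uS eBt eB]]].
rewrite /= in eBt eB; exists (R *m B^T *m R^T).
  have := unitmx1 F j; rewrite -eBt !unitmx_mul unitmx_tr => /andP[/andP[-> ->] _].
  by rewrite unitmx_tr.
rewrite !trmx_mul !trmxK -eB !mulmxA; congr (_ *m _).
have SRB : S *m R *m B^T = 1%:M.
  apply: mulmx1C; rewrite !mulmxA; apply: mulmx1C; rewrite !mulmxA.
  by rewrite eBt.
by rewrite -!mulmxA [S *m _]mulmxA SRB mulmx1.
Qed.

Definition kblock_swap (b : kblock F) :=
  match b with
  | KJordan n a => KJordan_swap n a
  | KInfty n => KJordan n 0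
  | _ => b
  end.

Lemma iso_swap_block b : kblock_ok b -> pswap (kpencil b) =~ kpencil (kblock_swap b).
Proof.
have ptrK (P : pencil F) : ptr (ptr P) = P by case: P => *; rewrite /ptr /= !trmxK.
case: b => [n a|n|n|n] /= okb.
- rewrite -[pswap _]ptrK; apply: iso_trans (iso_tr (iso_swap_jordan a okb)) _.
  apply: iso_trans (iso_tr_block _) _; rewrite /KJordan_swap.
  by case: eqP => _; apply: iso_refl.
- exact: iso_refl.
- rewrite -[pswap _]ptrK; apply: iso_trans (iso_tr (iso_swap_FG F n)) _.
  exact: iso_tr_block.
exact: iso_swap_FG.
Qed.

Lemma iso_swap_ksum K : all (@kblock_ok F) K -> pswap (ksum K) =~ ksum (map kblock_swap K).
Proof.
elim: K => [|b K IH] /=; first by move=> _; apply: iso_refl.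
move=> /andP[okb okK]; rewrite !ksum_cons.
exact: iso_add (iso_swap_block okb) (IH okK).
Qed.

(** The first three conditions express invariance under transposing and swapping the pencil; the
    last two concern the Jordan blocks that are not cosquares although their eigenvalue is its own
    inverse. *)
Definition balanced K :=
  [/\ forall n, count_mem (KFG F n) K = count_mem (KFGtr F n) K,
      forall n, (0 < n)%N -> count_mem (KJordan n 0) K = count_mem (KInfty F n) K,
      forall n (a : F), (0 < n)%N -> a != 0 ->
        count_mem (KJordan n a) K = count_mem (KJordan n a^-1) K,
      forall n, (0 < n)%N -> ~~ odd n -> ~~ odd (count_mem (KJordan n 1) K)
    & forall n, odd n -> ~~ odd (count_mem (KJordan n (-1)) K)].

Lemma eq_KJordan n m (a c : F) : (KJordan n a == KJordan m c) = (n == m) && (a == c).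
Proof. by apply/eqP/andP => [[-> ->]|[/eqP-> /eqP->]]; rewrite ?eqxx. Qed.

Lemma form_balanced n (A : 'M[F]_n) K :
  all (@kblock_ok F) K -> Pencil A^T A =~ ksum K -> balanced K.
Proof.
move=> okK hK.
have ok_tr : all (@kblock_ok F) (map (@kblock_tr F) K).
  by rewrite all_map; apply: sub_all okK; case.
have ok_swap : all (@kblock_ok F) (map kblock_swap K).
  rewrite all_map; apply: sub_all okK; case=> //= m a okm.
  by rewrite /KJordan_swap; case: eqP.
(* Transposing (A^T, A) gives (A, A^T), which is also its swap. *)
have iso_ts : ksum (map (@kblock_tr F) K) =~ ksum (map kblock_swap K).
  apply: iso_trans (iso_sym (iso_tr_ksum K)) _.
  apply: iso_trans (iso_tr (iso_sym hK)) _; rewrite /ptr /= trmxK.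
  exact: iso_trans (iso_swap hK) (iso_swap_ksum okK).
have countJ m a : (0 < m)%N -> count_mem (KJordan m a) K =
    count (fun b => kblock_swap b == KJordan m a) K.
  move=> m_gt0; have := count_jordan_iso a ok_tr ok_swap iso_ts m_gt0.
  rewrite !count_map => <-; apply: eq_count; by case.
split.
- move=> m; have := count_FG_iso m ok_tr ok_swap iso_ts; rewrite !count_map.
  have -> : count (preim kblock_swap (pred1 (KFG F m))) K = count_mem (KFG F m) K.
    by apply: eq_count => -[k a|k|k|k] //=; rewrite /KJordan_swap; case: (a == 0).
  by move=> <-; apply: eq_count => -[k a|k|k|k].
- move=> m m_gt0; rewrite countJ //; apply: eq_count => -[k a|k|k|k] //=.
    rewrite /KJordan_swap; case: (eqVneq a 0) => [->|nz_a] //.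
    by rewrite eq_KJordan invr_eq0 (negPf nz_a) andbF.
  by rewrite eq_KJordan eqxx andbT; apply/eqP/eqP => [->|[->]].
- move=> m a m_gt0 nz_a; rewrite countJ //; apply: eq_count => -[k c|k|k|k] //=.
    rewrite /KJordan_swap; case: (eqVneq c 0) => [->|nz_c].
      by rewrite eq_KJordan [0 == _]eq_sym invr_eq0 (negPf nz_a) andbF.
    by rewrite !eq_KJordan (can2_eq invrK invrK).
  by rewrite eq_KJordan [0 == _]eq_sym (negPf nz_a) andbF.
(* The sizes [j] next to [m] have the opposite parity, for which the Jordan block of eigenvalue 1 is
   a cosquare. *)
- move=> m m_gt0 even_m; apply: (count_jordan_even two_neq0 _ okK hK m_gt0) => j hj.
  apply: jordan_cosquare; rewrite -signr_odd.
  have -> : odd j.+1 = false by lia.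
  by rewrite expr0.
move=> m odd_m; have m_gt0 : (0 < m)%N by case: (m) odd_m.
apply: (count_jordan_even two_neq0 _ okK hK m_gt0) => j hj.
apply: jordan_cosquare; rewrite -signr_odd.
have -> : odd j.+1 = true by lia.
by rewrite expr1.
Qed.

Definition kform_of (b : tblock F) : seq (kblock F) :=
  match b with
  | Type1 k a => [:: KJordan k a; KJordan_swap k a]
  | Type2 n true => [:: KJordan n ((-1) ^+ n.+1)]
  | Type2 n false => if odd n then [:: KFG F n./2; KFGtr F n./2]
                     else [:: KJordan n./2 (-1); KJordan n./2 (-1)]
  | Type3 k => [:: KJordan (2 * k) 1; KJordan (2 * k) 1]
  end.

Lemma type1_iso k (a : F) : (0 < k)%N -> a != 1 -> a != -1 ->
  Pencil (type1_mx k a)^T (type1_mx k a) =~ ksum [:: KJordan k a; KJordan_swap k a].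
Proof.
move=> k_gt0 a1 aN1; apply: (tridiag_even (y := a)) => //; last by move=> j; rewrite if_same.
by rewrite -expr2 sqrf_eq1 negb_or a1.
Qed.

Lemma type2_odd_iso k :
  Pencil (type2_mx F (2 * k + 1) false)^T (type2_mx F (2 * k + 1) false) =~
  ksum [:: KFG F k; KFGtr F k].
Proof.
apply: (@tridiag_odd F k (-1) 1); last exact: alt_signE.
by rewrite mulr1 eq_sym one_neqN1.
Qed.

Lemma type2_even_iso k : (0 < k)%N ->
  Pencil (type2_mx F (2 * k) false)^T (type2_mx F (2 * k) false) =~
  ksum [:: KJordan k (-1); KJordan k (-1)].
Proof.
move=> k_gt0; have h : (-1 : F) * 1 != 1 by rewrite mulr1 eq_sym one_neqN1.
have := tridiag_even k_gt0 h (@alt_signE F).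
by rewrite /KJordan_swap oppr_eq0 oner_eq0 invrN invr1.
Qed.

Lemma type3_iso k : (0 < k)%N ->
  Pencil (type3_mx F k)^T (type3_mx F k) =~
  ksum [:: KJordan (2 * k) 1; KJordan (2 * k) 1].
Proof.
move=> k_gt0; have h : (1 : F) * -1 != 1 by rewrite mul1r eq_sym one_neqN1.
have subE j : (-1) ^+ j = if odd j then -1 else 1 :> F.
  by rewrite -signr_odd; case: odd; rewrite ?expr0 ?expr1.
have k2 : (0 < 2 * k)%N by rewrite muln_gt0.
have := tridiag_even k2 h subE; rewrite /KJordan_swap oner_eq0 invr1.
apply: iso_trans; apply: iso_entries; rewrite ?mulnA // => i j i' j' ei ej.
by rewrite !mxE ei ej.
Qed.

Lemma tblock_iso b : tblock_ok b -> Pencil (tmx b)^T (tmx b) =~ ksum (kform_of b).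
Proof.
case: b => [k a|n [] |k] /=.
- by case/and3P; apply: type1_iso.
- case/andP=> n_gt0 _; apply: iso_trans (type2_corner_iso two_neq0 n_gt0) _.
  exact/iso_sym/ksum1.
- case/andP=> n_gt0 _; have := odd_double_half n.
  case: ifP => _ en.
    have := type2_odd_iso n./2; suff -> : (2 * n./2 + 1 = n)%N by [].
    by rewrite -[RHS]en mul2n addnC.
  have h : (0 < n./2)%N by move: en n_gt0; lia.
  have := type2_even_iso h; suff -> : (2 * n./2 = n)%N by [].
  by rewrite -[RHS]en mul2n.
exact: type3_iso.
Qed.

Lemma kform_of_ok b : tblock_ok b -> all (@kblock_ok F) (kform_of b).
Proof.
case: b => [k a|n [] |k] /=.
- by case/and3P=> k_gt0 _ _; rewrite /KJordan_swap k_gt0; case: eqP => /=; rewrite k_gt0.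
- by case/andP=> ->.
- by case/andP=> n_gt0 _; case: ifP => //= on; rewrite -(odd_double_half n) on in n_gt0 *;
    case: (n./2) n_gt0 => //= *; rewrite ?doubleK.
by move=> k_gt0; rewrite muln_gt0 k_gt0.
Qed.

Definition kforms s := flatten (map kform_of s).

Lemma kforms_ok s : all (@tblock_ok F) s -> all (@kblock_ok F) (kforms s).
Proof. by elim: s => //= b s IH /andP[okb oks]; rewrite all_cat kform_of_ok // IH. Qed.

Lemma tsum_iso s : all (@tblock_ok F) s ->
  Pencil (dsum (@tmx F) s)^T (dsum (@tmx F) s) =~ ksum (kforms s).
Proof.
elim: s => [|b s IH] /=; first by rewrite trmx0 => _; apply: iso_refl.
case/andP=> okb oks; apply: iso_trans (iso_sym (ksum_cat _ _)).
apply: iso_trans (iso_add (tblock_iso okb) (IH oks)).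
by rewrite /padd /= tr_block_mx !trmx0; apply: iso_refl.
Qed.

Lemma congruent_iso n (A B : 'M[F]_n) : congruent A B -> Pencil A^T A =~ Pencil B^T B.
Proof.
move=> [S uS eB]; apply/pair_equiv_iso; exists S^T, S; rewrite unitmx_tr uS; split=> //.
by rewrite -eB !trmx_mul trmxK mulmxA.
Qed.

(** This replaces congruence by equivalence of pencils, and so reduces the classification to the
    combinatorics of multiplicities. *)
Lemma tridiag_form_iso n (A : 'M[F]_n) s :
  tridiag_form A s <-> all (@tblock_ok F) s /\ Pencil A^T A =~ ksum (kforms s).
Proof.
split=> [[oks [e cA]]|[oks hA]]; split=> //.
  subst n; rewrite castmx_id in cA.
  exact: iso_trans (congruent_iso cA) (tsum_iso oks).
have hT := tsum_iso oks.
have [/= _ e] := iso_dim (iso_trans hT (iso_sym hA)); exists e; subst n.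
rewrite castmx_id; apply: congruent_of_iso => //.
exact: iso_trans hA (iso_sym hT).
Qed.
End Classification.

(** * Classification *)
Section Assembly.
Variable F : closedFieldType.
Hypothesis two_neq0 : 2%:R != 0 :> F.
Implicit Types (K : seq (kblock F)) (s : seq (tblock F)) (b c t : tblock F).

Lemma sub_count2 (T : eqType) (x y : T) (r : seq T) :
    (if x == y then 1 < count_mem x r else (x \in r) && (y \in r))%N ->
  exists r', perm_eq r ([:: x; y] ++ r').
Proof.
case: eqP => [<-|/eqP xy] h.
  have xr : x \in r by rewrite -has_pred1 has_count ltnW.
  have /permP/(_ (pred1 x)) e := perm_to_rem xr.
  have xr2 : x \in rem x r.
    rewrite -has_pred1 has_count; move: e h => /=; rewrite eqxx; lia.
  exists (rem x (rem x r)).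
  by apply: perm_trans (perm_to_rem xr) _; rewrite perm_cons perm_to_rem.
have /andP[xr yr] := h; exists (rem y (rem x r)).
apply: perm_trans (perm_to_rem xr) _; rewrite perm_cons perm_to_rem //.
by rewrite -has_pred1 has_count; have /permP/(_ (pred1 y)) /= := perm_to_rem xr;
  rewrite (negPf xy) add0n => <-; rewrite -has_count has_pred1.
Qed.

Lemma balanced_diff K0 K1 K : perm_eq K (K0 ++ K1) ->
  balanced K -> balanced K0 -> balanced K1.
Proof.
move=> /permP eK [h1 h2 h3 h4 h5] [g1 g2 g3 g4 g5].
have {}eK (x : kblock F) : count_mem x K = (count_mem x K0 + count_mem x K1)%N.
  by rewrite eK count_cat.
split=> [n|n n0|n a n0 a0|n n0 en|n on].
- by have := h1 n; have := g1 n; rewrite !eK; lia.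
- by have := h2 n n0; have := g2 n n0; rewrite !eK; lia.
- by have := h3 n a n0 a0; have := g3 n a n0 a0; rewrite !eK; lia.
- by have := h4 n n0 en; have := g4 n n0 en; rewrite eK oddD => /negbTE->.
by have := h5 n on; have := g5 n on; rewrite eK oddD => /negbTE->.
Qed.

Lemma kform_of_balanced b : tblock_ok b -> balanced (kform_of b).
Proof.
by move=> okb; apply: (form_balanced two_neq0 (kform_of_ok okb) (tblock_iso two_neq0 okb)).
Qed.

(** Balance supplies the partner of [b], or a second copy of it, and the two together form the
    Kronecker form of a tridiagonal block. Jordan blocks of eigenvalue 1 and odd size, or -1 and
    even size, stand alone. *)
Lemma exists_tblock (b : kblock F) K : all (@kblock_ok F) K -> balanced K -> b \in K ->
  exists t, tblock_ok t /\ exists K', perm_eq K (kform_of t ++ K').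
Proof.
move=> okK [h1 h2 h3 h4 h5] bK; have okb := allP okK _ bK.
have swap_in (x y : kblock F) : count_mem x K = count_mem y K -> (x \in K) = (y \in K).
  by rewrite -!has_pred1 !has_count => ->.
have even_in (x : kblock F) : ~~ odd (count_mem x K) -> x \in K -> (1 < count_mem x K)%N.
  by rewrite -has_pred1 has_count; lia.
have FGcase n : KFG F n \in K -> exists t, tblock_ok t /\ exists K', perm_eq K (kform_of t ++ K').
  move=> FGK; exists (Type2 F (2 * n + 1) false); split; first by rewrite /=; lia.
  have e : kform_of (Type2 F (2 * n + 1) false) = [:: KFG F n; KFGtr F n].
    rewrite /= (_ : odd _); last by lia.
    by rewrite (_ : (2 * n + 1)./2 = n) //; lia.
  by rewrite e; apply: sub_count2; rewrite /= FGK -(swap_in _ _ (h1 n)).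
have zero_case n : (0 < n)%N -> KJordan n 0 \in K ->
    exists t, tblock_ok t /\ exists K', perm_eq K (kform_of t ++ K').
  move=> n_gt0 JK; exists (Type1 n 0); split.
    by rewrite /= n_gt0 eq_sym oner_eq0 eq_sym oppr_eq0 oner_eq0.
  rewrite /= /KJordan_swap eqxx; apply: sub_count2.
  by rewrite /= JK -(swap_in _ _ (h2 n n_gt0)).
case: b okb bK => [n a|n|n|n] /= okb bK; last 1 first.
- by apply: (FGcase n); rewrite (swap_in _ _ (h1 n)).
- case: (eqVneq a 0) bK => [->|nz_a] bK; first exact: zero_case bK.
  case: (eqVneq a 1) bK => [->|a1] bK.
    case on : (odd n).
      exists (Type2 F n true); split; first by rewrite /= okb implybT.
      rewrite /= -signr_odd /= on expr0; exists (rem (KJordan n 1) K).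
      exact: perm_to_rem.
    exists (Type3 F n./2); split; first by rewrite /=; lia.
    rewrite /= (_ : (2 * n./2)%N = n); last by lia.
    by apply: sub_count2; rewrite eqxx even_in // h4 // on.
  case: (eqVneq a (-1)) bK => [->|aN1] bK.
    case on : (odd n).
      exists (Type2 F (2 * n) false); split; first by rewrite /=; lia.
      rewrite /= (_ : odd (2 * n) = false); last by lia.
      rewrite (_ : (2 * n)./2 = n); last by lia.
      by apply: sub_count2; rewrite eqxx even_in // h5.
    exists (Type2 F n true); split; first by rewrite /= okb implybT.
    rewrite /= -signr_odd /= on expr1; exists (rem (KJordan n (-1)) K).
    exact: perm_to_rem.
  exists (Type1 n a); split; first by rewrite /= okb a1.
  rewrite /= /KJordan_swap (negPf nz_a); apply: sub_count2.
  rewrite eq_KJordan eqxx /= ifN; first by rewrite bK -(swap_in _ _ (h3 n a okb nz_a)).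
  apply: contra a1 => /eqP e; have : a ^+ 2 == 1 by rewrite expr2 {2}e mulfV.
  by rewrite sqrf_eq1 (negPf aN1) orbF.
- by apply: (zero_case n okb); rewrite (swap_in _ _ (h2 n okb)).
exact: FGcase bK.
Qed.

Lemma balanced_decomposition K : all (@kblock_ok F) K -> balanced K ->
  exists2 s, all (@tblock_ok F) s & perm_eq K (kforms s).
Proof.
have [m] := ubnP (size K); elim: m K => // m IH [|b K0] lt_m okK balK.
  by exists [::].
set K := b :: K0 in lt_m okK balK *.
have [t [okt [K' pK]]] := exists_tblock okK balK (mem_head b K0).
have szt : (0 < size (kform_of t))%N by case: (t) => [k a|n []|k] //=; case: ifP.
have [||s oks ps] := IH K' _ _ (balanced_diff pK balK (kform_of_balanced okt)).
- move: lt_m; rewrite (perm_size pK) size_cat ltnS; apply: leq_trans.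
  by rewrite -add1n leq_add2r.
- by move: okK; rewrite (perm_all _ pK) all_cat => /andP[].
exists (t :: s); first by rewrite /= okt.
by apply: perm_trans pK _; rewrite /kforms /= perm_cat2l.
Qed.

(** A Kronecker block occurring in the form of [b] and only in forms of tridiagonal blocks similar
    to [b], with its number of occurrences there. Counting it recovers multiplicities up to
    similarity. *)
Definition signature (b : tblock F) : kblock F * nat :=
  match b with
  | Type1 k a => (KJordan k a, 1%N)
  | Type2 n true => (KJordan n ((-1) ^+ n.+1), 1%N)
  | Type2 n false => if odd n then (KFG F n./2, 1%N) else (KJordan n./2 (-1), 2)
  | Type3 k => (KJordan (2 * k) 1, 2)
  end.

Lemma eq_Type2 n m e e' : (Type2 F n e == Type2 F m e') = (n == m) && (e == e').
Proof. by apply/eqP/andP => [[-> ->]|[/eqP-> /eqP->]]; rewrite ?eqxx. Qed.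

Lemma count_signature b t : tblock_ok b -> tblock_ok t ->
  count_mem (signature b).1 (kform_of t) = ((signature b).2 * tblock_sim b t)%N.
Proof.
have N11 : (-1 == 1 :> F) = false by rewrite eq_sym (negPf (one_neqN1 two_neq0)).
have P11 : (1 == -1 :> F) = false by rewrite eq_sym N11.
have count_Type1 k a m (c : F) : (c == 1) || (c == -1) -> a != 1 -> a != -1 ->
    count_mem (KJordan m c) [:: KJordan k a; KJordan_swap k a] = 0%N.
  move=> c1 a1 aN1.
  have ac : (a == c) = false by apply/negbTE; case/orP: c1 => /eqP->.
  have aVc : (a^-1 == c) = false.
    by rewrite (can2_eq invrK invrK); apply/negbTE; case/orP: c1 => /eqP->;
      rewrite ?invrN ?invr1.
  rewrite /= eq_KJordan ac andbF /KJordan_swap.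
  by case: (a == 0); rewrite //= eq_KJordan aVc andbF.
case: b => [k a|n [|]|k] okb; case: t => [k' a'|m [|]|k'] okt;
  rewrite /= ?alt_signE ?eq_KJordan ?eq_Type2.
- case/and3P: okb => k_gt0 a1 aN1; case/and3P: okt => _ a1' aN1'.
  rewrite mul1n addn0 [k' == k]eq_sym [a' == a]eq_sym /KJordan_swap.
  case: (eqVneq a' 0) => [->|nz]; first by rewrite invr0 orbb /= addn0.
  rewrite eq_KJordan [k' == k]eq_sym [a'^-1 == a]eq_sym; case: (k == k') => //=.
  case: (eqVneq a a') => [ea|] //=; rewrite -?ea.
  (* The block is counted once and not twice, since a = a^-1 would force [a] to be 1 or -1. *)
  have -> // : (a == a^-1) = false.
  apply/negbTE; apply: contra a1 => /eqP e; have : a ^+ 2 == 1.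
    by rewrite expr2 {2}e mulfV // ea.
  by rewrite sqrf_eq1 (negPf aN1) orbF.
- case/and3P: okb => _ a1 aN1; rewrite /alt_sign; case: odd;
  by rewrite [_ == a]eq_sym ?(negPf a1) ?(negPf aN1) andbF.
- case/and3P: okb => _ a1 aN1; case: ifP => //= _; rewrite !eq_KJordan.
  by rewrite [_ == a]eq_sym (negPf aN1) andbF.
- by case/and3P: okb => _ a1 aN1; rewrite [_ == a]eq_sym (negPf a1) andbF.
- case/and3P: okt => _ a1 aN1.
  by rewrite -[LHS]/(count_mem _ [:: KJordan k' a'; KJordan_swap k' a']) count_Type1 // /alt_sign;
    case: odd; rewrite eqxx ?orbT.
- by case: (eqVneq m n) => [->|_] //=; rewrite !eqxx.
- rewrite andbF; case: ifP => //= em; rewrite !eq_KJordan; move: okt => /= /andP[_ ok4].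
  (* Here [m] is even and not a multiple of 4, so [n = m./2] is odd and the corner block has
     eigenvalue 1, not -1. *)
  case: (eqVneq m./2 n) => //= e.
  have -> : alt_sign F n = 1 by rewrite /alt_sign -e; move: ok4 em; case: ifP => //; lia.
  by rewrite N11.
- case: (eqVneq (2 * k')%N n) => //= <-.
  by rewrite /alt_sign mul2n odd_double P11.
- case/and3P: okt => _ a1 aN1; case: ifP => on /=.
    by rewrite /KJordan_swap; case: (a' == 0).
  by rewrite -[LHS]/(count_mem _ [:: KJordan k' a'; KJordan_swap k' a']) count_Type1 // eqxx orbT.
- rewrite andbF muln0; case: ifP => on //=; rewrite eq_KJordan.
  case: (eqVneq m n./2) => //= e.
  have -> : alt_sign F m = 1.
    by rewrite /alt_sign e; move: okb on => /= /andP[_]; case: ifP => //; lia.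
  by rewrite P11.
- rewrite andbT; case: ifP => on; case: ifP => om //=; rewrite ?eq_KJordan ?eqxx ?andbT.
  + rewrite (_ : (KFG F m./2 == KFG F n./2) = (n == m)); first by case: eqP.
    by apply/eqP/eqP => [[e]|->] //; lia.
  + by have -> : (n == m) = false by apply/negbTE; apply/eqP; lia.
  + by have -> : (n == m) = false by apply/negbTE; apply/eqP; lia.
  + have -> : (m./2 == n./2) = (n == m) by apply/eqP/eqP; lia.
    by case: eqP.
- case: ifP => on //=; rewrite !eq_KJordan P11 andbF.
  by [].
- case/and3P: okt => _ a1 aN1.
  by rewrite -[LHS]/(count_mem _ [:: KJordan k' a'; KJordan_swap k' a']) count_Type1 // eqxx.
- case: (eqVneq m (2 * k)%N) => //= ->.
  by rewrite /alt_sign mul2n odd_double N11.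
- by case: ifP => //= _; rewrite !eq_KJordan N11 andbF.
have -> : ((2 * k')%N == (2 * k)%N) = (k == k') by rewrite eqn_pmul2l // eq_sym.
have -> : (Type3 F k == Type3 F k') = (k == k') by apply/eqP/eqP => [[]|->].
by rewrite eqxx andbT; case: (k == k').
Qed.

Lemma tblock_simxx b : tblock_sim b b.
Proof. by case: b => [k a|n e|k] //=; rewrite !eqxx. Qed.

Lemma tblock_sim_trans c b (b' : tblock F) : tblock_sim b b' -> tblock_sim c b = tblock_sim c b'.
Proof.
case: b b' => [k a|n e|k] [k' a'|n' e'|k'] //=; try by move/eqP->.
case/andP=> /eqP-> /orP[] /eqP->; case: c => //= k0 a0.
by rewrite invrK orbC.
Qed.

Lemma all2_cat (S T : Type) (r : S -> T -> bool) (u1 u2 : seq S) (v1 v2 : seq T) :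
  size u1 = size v1 -> all2 r (u1 ++ u2) (v1 ++ v2) = all2 r u1 v1 && all2 r u2 v2.
Proof.
elim: u1 v1 => [|x u1 IH] [|y v1] //= [eq_size].
by rewrite IH // andbA.
Qed.

(** Greedy matching: the head of [s] has a similar partner in [s'], and deleting both preserves the
    counts, since similar blocks are similar to the same blocks. *)
Lemma same_summands_count s s' :
    (forall c, tblock_ok c -> count (tblock_sim c) s = count (tblock_sim c) s') ->
    all (@tblock_ok F) s -> all (@tblock_ok F) s' ->
  same_summands s s'.
Proof.
elim: s s' => [|b s IH] s' eq_count_s.
  case: s' eq_count_s => [|b' s'] eqc _ /=; first by exists [::].
  by case/andP=> okb' _; have := eqc b' okb'; rewrite /= tblock_simxx.
case/andP=> okb oks oks'.
have : has (tblock_sim b) s'.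
  by rewrite has_count -eq_count_s //= tblock_simxx.
case/hasP=> b' b's' bb'; case/splitPr: b's' eq_count_s oks' => p1 p2 eqc oks'.
have [t pt] : same_summands s (p1 ++ p2).
  apply: IH => // [c okc|].
    have := eqc c okc; rewrite /= !count_cat /= (tblock_sim_trans c bb'); lia.
  by move: oks'; rewrite !all_cat /= => /and3P[-> _ ->].
move=> sim_t.
have szt : size t = size (p1 ++ p2) by move: sim_t; rewrite all2E => /andP[/eqP].
exists (take (size p1) t ++ b :: drop (size p1) t).
  rewrite perm_sym perm_catC /= perm_cons perm_catC cat_take_drop perm_sym.
  exact: pt.
have szp : size (take (size p1) t) = size p1 by rewrite size_takel // szt size_cat leq_addr.
move: sim_t; rewrite -{1}(cat_take_drop (size p1) t) !all2_cat // => /andP[-> /= ->].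
by rewrite bb'.
Qed.

(** Stated for two matrices with equivalent pencils, this yields both the uniqueness in (a), where
    the matrices coincide, and the dependence on the Kronecker form in (b). *)
Lemma tridiag_form_unique n n' (A : 'M[F]_n) (A' : 'M[F]_n') s s' :
  tridiag_form A s -> tridiag_form A' s' -> Pencil A^T A =~ Pencil A'^T A' ->
  same_summands s s'.
Proof.
move=> /(tridiag_form_iso two_neq0)[oks hs] /(tridiag_form_iso two_neq0)[oks' hs'] hA.
have iso : ksum (kforms s) =~ ksum (kforms s').
  exact: iso_trans (iso_sym hs) (iso_trans hA hs').
have count_kforms c s0 : tblock_ok c -> all (@tblock_ok F) s0 ->
    count_mem (signature c).1 (kforms s0) = ((signature c).2 * count (tblock_sim c) s0)%N.
  move=> okc; elim: s0 => [|t s0 IH] /=; first by rewrite muln0.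
  by case/andP=> okt oks0; rewrite count_cat count_signature // IH // mulnDr.
apply: same_summands_count => // c okc.
have : ((signature c).2 * count (tblock_sim c) s = (signature c).2 * count (tblock_sim c) s')%N.
  rewrite -!count_kforms //.
  case: c okc => [k a|n0 e|k] /=.
  - by case/and3P=> k_gt0 _ _; apply: count_jordan_iso; rewrite ?kforms_ok.
  - case/andP=> n_gt0 _; case: e; first by apply: count_jordan_iso; rewrite ?kforms_ok.
    case: ifP => on; first by apply: count_FG_iso; rewrite ?kforms_ok.
    by apply: count_jordan_iso; rewrite ?kforms_ok //; move: n_gt0 on; lia.
  by move=> k_gt0; apply: count_jordan_iso; rewrite ?kforms_ok // muln_gt0.
move/eqP; rewrite eqn_mul2l => /orP[|/eqP//].
by case: (c) => [k a|n0 []|k] //=; case: ifP.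
Qed.

Lemma tridiag_form_exists n (A : 'M[F]_n) : exists s, tridiag_form A s.
Proof.
have [K okK hK] := kronecker_exists (Pencil A^T A).
have [s oks ps] := balanced_decomposition okK (form_balanced two_neq0 okK hK).
exists s; apply/tridiag_form_iso => //; split=> //.
exact: iso_trans hK (ksum_perm ps).
Qed.

Lemma type1_congruent k (a : F) : (0 < k)%N -> a != 0 -> a != 1 -> a != -1 ->
  congruent (type1_mx k a) (type1_mx k a^-1).
Proof.
move=> k_gt0 a0 a1 aN1; apply: congruent_of_iso => //.
apply: iso_trans (type1_iso k_gt0 a1 aN1) _.
have h1 : a^-1 != 1 by rewrite invr_eq1.
have h2 : a^-1 != -1 by rewrite (can2_eq invrK invrK) invrN invr1.
apply: iso_trans (iso_sym (type1_iso k_gt0 h1 h2)).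
rewrite /KJordan_swap invr_eq0 (negPf a0) invrK; apply: ksum_perm.
by rewrite -cat1s perm_catC.
Qed.
End Assembly.

Theorem theorem1p1 (F : closedFieldType) (hF : 2%N \notin [pchar F]) :
  (* (a) *)
  [/\ forall (n : nat) (A : 'M[F]_n), exists s : seq (tblock F), tridiag_form A s,
      forall (n : nat) (A : 'M[F]_n) (s s' : seq (tblock F)),
        tridiag_form A s -> tridiag_form A s' -> same_summands s s'
    & forall (k : nat) (a : F), (0 < k)%N -> a != 0 -> a != 1 -> a != -1 ->
        congruent (type1_mx k a) (type1_mx k a^-1)]
  /\
  (* (b) *)
  (forall (n n' : nat) (A : 'M[F]_n) (A' : 'M[F]_n')
      (K K' : seq (kblock F)) (s s' : seq (tblock F)),
     kronecker_form A^T A K -> kronecker_form A'^T A' K' -> perm_eq K K' ->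
     tridiag_form A s -> tridiag_form A' s' -> same_summands s s')
  /\
  [/\ forall (k : nat) (a : F), (0 < k)%N -> a != 1 -> a != -1 ->
        kronecker_form (type1_mx k a)^T (type1_mx k a)
          [:: KJordan k a; KJordan_swap k a],
      forall k : nat,
        kronecker_form (type2_mx F (2 * k + 1) false)^T
          (type2_mx F (2 * k + 1) false) [:: KFG F k; KFGtr F k],
      forall k : nat, odd k ->
        kronecker_form (type2_mx F (2 * k) false)^T (type2_mx F (2 * k) false)
          [:: KJordan k (-1); KJordan k (-1)],
      forall n : nat, (0 < n)%N ->
        kronecker_form (type2_mx F n true)^T (type2_mx F n true)
          [:: KJordan n ((-1) ^+ n.+1)]
    & forall k : nat, (0 < k)%N ->
        kronecker_form (type3_mx F k)^T (type3_mx F k)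
          [:: KJordan (2 * k) 1; KJordan (2 * k) 1]].
Proof.
have two_neq0 : 2%:R != 0 :> F by apply: contra hF => h; rewrite inE /= h.
split; [split | split; [|split]].
- exact: tridiag_form_exists.
- by move=> n A s s' hs hs'; apply: (tridiag_form_unique two_neq0 hs hs'); apply: iso_refl.
- exact: type1_congruent.
- move=> n n' A A' K K' s s' /kronecker_formE[_ hK] /kronecker_formE[_ hK'] pK hs hs'.
  apply: (tridiag_form_unique two_neq0 hs hs').
  exact: iso_trans hK (iso_trans (ksum_perm pK) (iso_sym hK')).
- move=> k a k_gt0 a1 aN1; apply/kronecker_formE; split; last exact: type1_iso.
  by apply: (@kform_of_ok _ (Type1 k a)); rewrite /= k_gt0 a1.
- by move=> k; apply/kronecker_formE; split; last exact: type2_odd_iso.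
- move=> k odd_k; have k_gt0 : (0 < k)%N by case: (k) odd_k.
  by apply/kronecker_formE; split; [rewrite /= k_gt0 | apply: type2_even_iso].
- move=> n n_gt0; apply/kronecker_formE; split; first by rewrite /= n_gt0.
  exact: iso_trans (type2_corner_iso two_neq0 n_gt0) (iso_sym (ksum1 _)).
move=> k k_gt0; apply/kronecker_formE; split; last exact: type3_iso.
by rewrite /= muln_gt0 k_gt0.
Qed.
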